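(* Let $H_{\alpha,\beta}=(\mathbb C^2\setminus\{0\})/\mathbb Z$ be a linear Hopf manifold, where $\mathbb Z$ is generated by $\gamma(z,w)=(\alpha z,\beta w)$ with $\alpha,\beta\in\mathbb C$, $|\alpha|\ge|\beta|>1$, endowed with the Gauduchon–Ornea lcK metric. Then $H_{\alpha,\beta}$ admits a local lcK immersion into $H^\infty_\lambda$ if and only if $\alpha=\beta$, and in this case $\lambda=|\alpha|=|\beta|$. Moreover, the immersion is full in $H^2_\lambda$.
   Context: **Gauduchon–Ornea metric.** Let $\Phi_{\alpha,\beta}>0$ be the unique positive function on $\mathbb C^2\setminus\{0\}$ satisfying $$|z_1|^2\,\Phi_{\alpha,\beta}^{-\frac{2\log|\alpha|}{\log|\alpha|+\log|\beta|}}+|z_2|^2\,\Phi_{\alpha,\beta}^{-\frac{2\log|\beta|}{\log|\alpha|+\log|\beta|}}=1 .$$ It is an automorphic Kähler potential on the covering $\mathbb C^2\setminus\{0\}$, and the lcK form on $H_{\alpha,\beta}$ is induced by $\Phi_{\alpha,\beta}^{-1}\,dd^c\Phi_{\alpha,\beta}$. **lcK immersions.** The classical Hopf manifold is $H^N_\lambda=(\mathbb C^N\setminus\{0\})/\mathbb Z$, where $\mathbb Z$ is generated by $\lambda\cdot\mathrm{id}$, $\lambda\in\mathbb C\setminus\{0\}$, $|\lambda|\ne1$, with lcK form $\omega_H=\|z\|^{-2}\omega_0$, $\omega_0=dd^c\|z\|^2$. $N=\infty$ is allowed, with $\mathbb C^\infty:=\ell^2(\mathbb C)$. A local lcK immersion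 of an lcK manifold $(M,\omega)$ (i.e. $d\omega=\theta\wedge\omega$ with $\theta$ a closed $1$-form) into $(H^N_\lambda,\omega_H)$: for every $x\in M$ there are a neighbourhood $U\ni x$ and a holomorphic map $F\colon U\to H^N_\lambda$ with $F^*\omega_H=\omega$. It is full if the dimension of the ambient space cannot be lowered.
   Formalization: The condition α=β is replaced by |α|=|β| (α=2, β=−2 also admits local immersions), and λ=|α|=|β| is stated as a value that works, not as forced, since local immersions exist for every admissible λ (e.g. α=β=2, λ=3). *)

(* Defs.v *)
From Stdlib Require Import Reals Lra Lia FunctionalExtensionality ProofIrrelevance
  Classical ClassicalChoice.
From Coquelicot Require Import Coquelicot.
Open Scope R_scope.

(** [Some n] is the finite dimension n, [None] is the dimension oo. *)
Definition dim := option nat.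

Definition beyond (N : dim) (k : nat) : Prop :=
  match N with Some n => (n <= k)%nat | None => False end.

Definition sqmod (u : nat -> C) (k : nat) : R := (Cmod (u k))².

(** C^N is realised, for finite N too, inside l^2(C): the square-summable
    sequences whose coordinates of index >= N vanish. *)
Record Cn (N : dim) : Type := mkCn {
  coord : nat -> C;
  coord_beyond : forall k, beyond N k -> coord k = RtoC 0;
  coord_summable : ex_series (sqmod coord) }.

Arguments mkCn {N} _ _ _.
Arguments coord {N} _ _.
Arguments coord_beyond {N} _ _ _.
Arguments coord_summable {N} _.

Lemma Cn_ext (N : dim) (x y : Cn N) : (forall k, coord x k = coord y k) -> x = y.
Proof.
  destruct x as [u hu su], y as [v hv sv]; simpl; intros H.
  assert (E : u = v) by (apply functional_extensionality; exact H).
  subst v; f_equal; apply proof_irrelevance.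
Qed.

Lemma sqmod_ge0 u k : 0 <= sqmod u k.
Proof. apply Rle_0_sqr. Qed.

Lemma Series_sqmod_ge0 u : ex_series (sqmod u) -> 0 <= Series (sqmod u).
Proof.
  intros H.
  replace 0 with (Series (fun _ : nat => 0 * 0)) by (rewrite Series_scal_l; ring).
  apply Series_le; [intros n; split; [lra | rewrite Rmult_0_l; apply sqmod_ge0] | exact H].
Qed.

Lemma ex_series_Rmult (c : R) (a : nat -> R) :
  ex_series a -> ex_series (fun k => c * a k).
Proof. intros H; exact (ex_series_scal_l (V := R_NormedModule) c a H). Qed.

Lemma ex_series_Rplus (a b : nat -> R) :
  ex_series a -> ex_series b -> ex_series (fun k => a k + b k).
Proof. intros Ha Hb; exact (ex_series_plus (V := R_NormedModule) a b Ha Hb). Qed.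

Lemma sqmod_young (s t : R) u v k :
  0 < s -> 0 < t -> s * t = 1 ->
  sqmod (fun k => Cplus (u k) (v k)) k <= (1 + s) * sqmod u k + (1 + t) * sqmod v k.
Proof.
  intros hs ht hst; unfold sqmod, Rsqr.
  pose proof (Cmod_triangle (u k) (v k)) as H.
  pose proof (Cmod_ge_0 (Cplus (u k) (v k))).
  set (a := Cmod (u k)) in *; set (b := Cmod (v k)) in *.
  set (c := Cmod (Cplus (u k) (v k))) in *.
  assert (Hc : c * c <= (a + b) * (a + b)) by (apply Rmult_le_compat; assumption).
  assert (Hs : 0 <= s * ((a - t * b) * (a - t * b)))
    by (apply Rmult_le_pos; [lra | apply Rle_0_sqr]).
  replace (s * ((a - t * b) * (a - t * b)))
    with (s * (a * a) - 2 * (s * t) * (a * b) + (s * t) * (t * (b * b))) in Hs by ring.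
  rewrite hst in Hs; lra.
Qed.

Lemma ex_series_sqmod_plus u v : ex_series (sqmod u) -> ex_series (sqmod v) ->
  ex_series (sqmod (fun k => Cplus (u k) (v k))).
Proof.
  intros Hu Hv.
  apply (ex_series_le (V := R_CompleteNormedModule) _
          (fun k => (1 + 1) * sqmod u k + (1 + 1) * sqmod v k)).
  - intros k; change (norm ?x) with (Rabs x).
    rewrite Rabs_pos_eq by apply sqmod_ge0.
    apply sqmod_young; lra.
  - apply ex_series_Rplus.
    + apply ex_series_Rmult; exact Hu.
    + apply ex_series_Rmult; exact Hv.
Qed.

Lemma sqmod_scal (c : C) u k :
  sqmod (fun k => Cmult c (u k)) k = (Cmod c)² * sqmod u k.
Proof. unfold sqmod; rewrite Cmod_mult, Rsqr_mult; reflexivity. Qed.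

Lemma ex_series_sqmod_scal (c : C) u : ex_series (sqmod u) ->
  ex_series (sqmod (fun k => Cmult c (u k))).
Proof.
  intros H; apply ex_series_ext with (fun k => (Cmod c)² * sqmod u k).
  - intros k; symmetry; apply sqmod_scal.
  - apply ex_series_Rmult; exact H.
Qed.

Lemma sqmod_opp u k : sqmod (fun k => Copp (u k)) k = sqmod u k.
Proof. unfold sqmod; rewrite Cmod_opp; reflexivity. Qed.

Section HilbertSpace.

Variable N : dim.

Definition Cn_plus (x y : Cn N) : Cn N.
Proof.
  refine (mkCn (fun k => Cplus (coord x k) (coord y k)) _ _).
  - intros k Hk; rewrite (coord_beyond x k Hk), (coord_beyond y k Hk); apply Cplus_0_l.
  - apply ex_series_sqmod_plus; apply coord_summable.
Defined.

Definition Cn_opp (x : Cn N) : Cn N.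
Proof.
  refine (mkCn (fun k => Copp (coord x k)) _ _).
  - intros k Hk; rewrite (coord_beyond x k Hk); ring.
  - apply ex_series_ext with (sqmod (coord x)).
    + intros k; symmetry; apply sqmod_opp.
    + apply coord_summable.
Defined.

Definition Cn_scal (c : C) (x : Cn N) : Cn N.
Proof.
  refine (mkCn (fun k => Cmult c (coord x k)) _ _).
  - intros k Hk; rewrite (coord_beyond x k Hk); ring.
  - apply ex_series_sqmod_scal, coord_summable.
Defined.

Definition Cn_zero : Cn N.
Proof.
  refine (mkCn (fun _ => RtoC 0) (fun _ _ => eq_refl) _).
  exists 0; apply (is_series_ext (fun _ : nat => scal 0 0)).
  - intros k; unfold sqmod; rewrite Cmod_0, Rsqr_0; apply Rmult_0_l.
  - apply filterlim_ext with (fun _ : nat => 0).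
    + intros n; induction n as [|n IH].
      * rewrite sum_O; symmetry; apply Rmult_0_l.
      * rewrite sum_Sn, <- IH; unfold plus, scal; simpl; unfold mult; simpl; ring.
    + apply filterlim_const.
Defined.

Definition Cn_norm (x : Cn N) : R := sqrt (Series (sqmod (coord x))).

Lemma Cn_norm_sqr x : (Cn_norm x)² = Series (sqmod (coord x)).
Proof. apply Rsqr_sqrt, Series_sqmod_ge0, coord_summable. Qed.

Lemma Cn_norm_ge0 x : 0 <= Cn_norm x.
Proof. apply sqrt_pos. Qed.

Lemma Cn_norm_eq0 x : Cn_norm x = 0 -> x = Cn_zero.
Proof.
  intros H; apply Cn_ext; intros k; apply Cmod_eq_0, Rsqr_eq_0.
  apply Rle_antisym; [|apply Rle_0_sqr].
  assert (S0 : Series (sqmod (coord x)) = 0) by (rewrite <- Cn_norm_sqr, H; apply Rsqr_0).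
  rewrite <- S0.
  rewrite (Series_incr_n _ (S k)); [simpl pred | lia | apply coord_summable].
  assert (0 <= Series (fun j => sqmod (coord x) (S k + j))).
  { apply (Series_sqmod_ge0 (fun j => coord x (S k + j))).
    apply (ex_series_incr_n (V := R_NormedModule) (sqmod (coord x)) (S k)).
    apply coord_summable. }
  assert (sqmod (coord x) k <= sum_f_R0 (sqmod (coord x)) k).
  { destruct k as [|k]; simpl; [lra|].
    pose proof (cond_pos_sum (sqmod (coord x)) k (sqmod_ge0 (coord x))); lra. }
  unfold sqmod in *; lra.
Qed.

Lemma Cn_norm_triangle x y : Cn_norm (Cn_plus x y) <= Cn_norm x + Cn_norm y.
Proof.
  destruct (Req_dec (Cn_norm x) 0) as [Ex|Ex].
  { rewrite (Cn_norm_eq0 x Ex) at 1.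
    replace (Cn_plus Cn_zero y) with y by (apply Cn_ext; intros k; simpl; ring).
    rewrite Ex; lra. }
  destruct (Req_dec (Cn_norm y) 0) as [Ey|Ey].
  { rewrite (Cn_norm_eq0 y Ey) at 1.
    replace (Cn_plus x Cn_zero) with x by (apply Cn_ext; intros k; simpl; ring).
    rewrite Ey; lra. }
  pose proof (Cn_norm_ge0 x); pose proof (Cn_norm_ge0 y).
  set (a := Cn_norm x) in *; set (b := Cn_norm y) in *.
  apply Rsqr_incr_0; [| apply Cn_norm_ge0 | lra].
  rewrite Cn_norm_sqr.
  apply Rle_trans with
    (Series (fun k => (1 + b / a) * sqmod (coord x) k + (1 + a / b) * sqmod (coord y) k)).
  - apply Series_le.
    + intros k; split; [apply sqmod_ge0|].
      apply sqmod_young; [apply Rdiv_lt_0_compat; lra | apply Rdiv_lt_0_compat; lra | field; lra].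
    + apply ex_series_Rplus.
      * apply ex_series_Rmult, coord_summable.
      * apply ex_series_Rmult, coord_summable.
  - rewrite Series_plus.
    + rewrite !Series_scal_l, <- !Cn_norm_sqr; fold a b.
      apply Req_le; unfold Rsqr; field; lra.
    + apply ex_series_Rmult, coord_summable.
    + apply ex_series_Rmult, coord_summable.
Qed.

Lemma Cn_norm_scal (c : C) x : Cn_norm (Cn_scal c x) = Cmod c * Cn_norm x.
Proof.
  unfold Cn_norm; simpl.
  rewrite (Series_ext _ (fun k => (Cmod c)² * sqmod (coord x) k)) by apply sqmod_scal.
  rewrite Series_scal_l, sqrt_mult_alt by apply Rle_0_sqr.
  rewrite sqrt_Rsqr; [reflexivity | apply Cmod_ge_0].
Qed.

Lemma Cn_norm_zero : Cn_norm Cn_zero = 0.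
Proof.
  replace Cn_zero with (Cn_scal (RtoC 0) Cn_zero) by (apply Cn_ext; intros k; simpl; ring).
  rewrite Cn_norm_scal, Cmod_0; ring.
Qed.

Lemma Cn_norm_opp x : Cn_norm (Cn_opp x) = Cn_norm x.
Proof. unfold Cn_norm; simpl; f_equal; apply Series_ext, sqmod_opp. Qed.

Definition Cn_AbelianMonoid_mixin : AbelianMonoid.mixin_of (Cn N).
Proof.
  apply (AbelianMonoid.Mixin (Cn N) Cn_plus Cn_zero);
    intros; apply Cn_ext; intros k; simpl; ring.
Defined.

Canonical Cn_AbelianMonoid := AbelianMonoid.Pack (Cn N) Cn_AbelianMonoid_mixin (Cn N).

Definition Cn_AbelianGroup_mixin : AbelianGroup.mixin_of Cn_AbelianMonoid.
Proof.
  apply (AbelianGroup.Mixin Cn_AbelianMonoid Cn_opp);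
    intros; apply Cn_ext; intros k; simpl; ring.
Defined.

Canonical Cn_AbelianGroup := AbelianGroup.Pack (Cn N)
  (AbelianGroup.Class (Cn N) Cn_AbelianMonoid_mixin Cn_AbelianGroup_mixin) (Cn N).

Definition Cn_ModuleSpace_mixin : ModuleSpace.mixin_of C_Ring Cn_AbelianGroup.
Proof.
  apply (ModuleSpace.Mixin C_Ring Cn_AbelianGroup Cn_scal);
    intros; apply Cn_ext; intros k; simpl; unfold mult, one, plus; simpl; ring.
Defined.

Canonical Cn_ModuleSpace := ModuleSpace.Pack C_Ring (Cn N)
  (ModuleSpace.Class C_Ring (Cn N)
     (AbelianGroup.class Cn_AbelianGroup) Cn_ModuleSpace_mixin) (Cn N).

Definition Cn_ball (x : Cn N) (e : R) (y : Cn N) : Prop := Cn_norm (minus y x) < e.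

Definition Cn_UniformSpace_mixin : UniformSpace.mixin_of (Cn N).
Proof.
  apply (UniformSpace.Mixin (Cn N) Cn_zero Cn_ball).
  - intros x e; unfold Cn_ball.
    replace (minus x x) with Cn_zero by (symmetry; exact (minus_eq_zero x)).
    rewrite Cn_norm_zero; apply cond_pos.
  - intros x y e H; unfold Cn_ball.
    replace (minus x y) with (Cn_opp (minus y x)) by exact (opp_minus y x).
    rewrite Cn_norm_opp; exact H.
  - intros x y z e1 e2 H1 H2; unfold Cn_ball in *.
    replace (minus z x) with (Cn_plus (minus z y) (minus y x))
      by (symmetry; exact (minus_trans y z x)).
    pose proof (Cn_norm_triangle (minus z y) (minus y x)); lra.
Defined.

Canonical Cn_UniformSpace := UniformSpace.Pack (Cn N) Cn_UniformSpace_mixin (Cn N).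

Canonical Cn_NormedModuleAux := NormedModuleAux.Pack C_AbsRing (Cn N)
  (NormedModuleAux.Class C_AbsRing (Cn N)
     (ModuleSpace.class _ Cn_ModuleSpace) Cn_UniformSpace_mixin) (Cn N).

Definition Cn_NormedModule_mixin : NormedModule.mixin_of C_AbsRing Cn_NormedModuleAux.
Proof.
  apply (NormedModule.Mixin C_AbsRing Cn_NormedModuleAux Cn_norm 1).
  - exact Cn_norm_triangle.
  - intros c x; apply Req_le; exact (Cn_norm_scal c x).
  - intros x y e H; exact H.
  - intros x y e H; rewrite Rmult_1_l; exact H.
  - exact Cn_norm_eq0.
Defined.

Canonical Cn_NormedModule := NormedModule.Pack C_AbsRing (Cn N)
  (NormedModule.Class C_AbsRing (Cn N)
     (NormedModuleAux.class C_AbsRing Cn_NormedModuleAux) Cn_NormedModule_mixin) (Cn N).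

End HilbertSpace.

Definition C2 : NormedModule C_AbsRing :=
  prod_NormedModule C_AbsRing C_NormedModule C_NormedModule.

(** The forms are given by their values on (constant) tangent vectors, the
    complex structure is J v = i v, and d^c f = - df o J = i (dbar - d) f, so
    that dd^c = 2 i d dbar. *)
Section Forms.

Context {V : NormedModule C_AbsRing}.

Definition dir_deriv (f : V -> R) (x v : V) : R :=
  Derive (fun t : R => f (plus x (scal (RtoC t) v))) 0.

Definition dc (f : V -> R) (x v : V) : R := - dir_deriv f x (scal Ci v).

(** Exterior derivative of a 1-form; no bracket term occurs since the vectors
    v and w are extended to constant vector fields. *)
Definition ext_deriv (eta : V -> V -> R) (x v w : V) : R :=
  dir_deriv (fun y => eta y w) x v - dir_deriv (fun y => eta y v) x w.

Definition ddc (f : V -> R) : V -> V -> V -> R := ext_deriv (dc f).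

Definition lck_form (Phi : V -> R) (x v w : V) : R := / Phi x * ddc Phi x v w.

End Forms.

(** Two vectors are identified when they differ by the action of the group Z
    generated by [g] (a bijection in all the uses below). *)
Definition orbit {V : Type} (g : V -> V) (z w : V) : Prop :=
  exists n : nat, w = Nat.iter n g z \/ z = Nat.iter n g w.

(** The points of (V \ {0}) / Z are the orbits; [fibre p] is the preimage of
    the point [p] under the covering V \ {0} -> (V \ {0}) / Z. *)
Record Hopf (V : NormedModule C_AbsRing) (g : V -> V) : Type := mkHopf {
  fibre : V -> Prop;
  fibre_orbit : exists z : V, z <> zero /\ fibre = orbit g z }.

Arguments fibre {V g} _ _.

Definition preimage {V : NormedModule C_AbsRing} {g : V -> V} (U : Hopf V g -> Prop)
  (z : V) : Prop := exists p, fibre p z /\ U p.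

Definition Hopf_open {V : NormedModule C_AbsRing} {g : V -> V} (U : Hopf V g -> Prop) : Prop :=
  open (preimage U).

Section Maps.

Context {V W : NormedModule C_AbsRing} {g : V -> V} {h : W -> W}.

Definition holomorphic_on (D : V -> Prop) (f : V -> W) : Prop :=
  forall z, D z -> ex_filterdiff f (locally z).

Definition lift_on (F : Hopf V g -> Hopf W h) (D : V -> Prop) (f : V -> W) : Prop :=
  open D /\ holomorphic_on D f /\
  forall z, D z -> z <> zero /\ forall p, fibre p z -> fibre (F p) (f z).

(** f^* omega = eta on [D]. *)
Definition pullback_on (D : V -> Prop) (f : V -> W)
  (omega : W -> W -> W -> R) (eta : V -> V -> V -> R) : Prop :=
  forall z, D z -> exists L : V -> W, filterdiff f (locally z) L /\
    forall v w : V, omega (f z) (L v) (L w) = eta z v w.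

(** [F] is holomorphic on the open set [U] (only its values there matter), with
    F^* omega = eta; [omega] and [eta] are forms on the coverings, invariant
    under [h] and [g]. *)
Definition lck_immersion_on (U : Hopf V g -> Prop) (F : Hopf V g -> Hopf W h)
  (omega : W -> W -> W -> R) (eta : V -> V -> V -> R) : Prop :=
  forall z, preimage U z ->
    exists D f, D z /\ lift_on F D f /\ pullback_on D f omega eta.

End Maps.

Definition linear_gen (a b : C) (z : C2) : C2 := (Cmult a (fst z), Cmult b (snd z)).

Definition H_lin (a b : C) : Type := Hopf C2 (linear_gen a b).

Lemma exp_tail (u p e : R) : 0 <= u -> 0 < p -> 0 < e -> exists M, forall s, M <= s -> u * exp (- p * s) <= e.
Proof.
  intros hu hp he. exists (u / (e * p)). intros s hs.
  assert (0 <= s) by (apply Rle_trans with (2:=hs); apply Rdiv_le_0_compat; nra).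
  destruct (Req_dec s 0) as [E|E].
  - assert (u / (e*p) = 0) by (apply Rle_antisym; [lra| apply Rdiv_le_0_compat; nra]).
    assert (u = 0). { replace u with (u/(e*p) * (e*p)) by (field; lra). rewrite H0; ring. }
    subst u; lra.
  - assert (hps : 0 < p*s) by (apply Rmult_lt_0_compat; lra).
    pose proof (exp_ineq1 (p*s) ltac:(lra)) as H1.
    replace (- p * s) with (- (p*s)) by ring. rewrite exp_Ropp.
    apply Rmult_le_reg_r with (exp (p*s)); [apply exp_pos|].
    rewrite Rmult_assoc, Rinv_l by (apply Rgt_not_eq, exp_pos).
    assert (u <= e * (p * s)).
    { apply Rmult_le_compat_r with (r:=e*p) in hs; [|nra].
      replace (u / (e*p) * (e*p)) with u in hs by (field; lra). nra. }
    nra.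
Qed.

Lemma potential_eq_unique (u v p q s t : R) : 0 <= u -> 0 <= v -> 0 < u + v -> 0 < p -> 0 < q ->
  u * exp (- p * s) + v * exp (- q * s) = 1 -> u * exp (- p * t) + v * exp (- q * t) = 1 -> s = t.
Proof.
  intros hu hv huv hp hq.
  assert (K : forall a b, a < b -> u * exp (- p * b) + v * exp (- q * b) < u * exp (- p * a) + v * exp (- q * a)).
  { intros a b hab.
    assert (exp (- p * b) < exp (- p * a)) by (apply exp_increasing; nra).
    assert (exp (- q * b) < exp (- q * a)) by (apply exp_increasing; nra).
    destruct (Rle_lt_or_eq_dec 0 u hu) as [Hu|<-]; nra. }
  intros Hs Ht; destruct (Rtotal_order s t) as [H|[H|H]]; [|exact H|];
    specialize (K _ _ H); lra.
Qed.

Lemma potential_eq_exists (u v p q : R) : 0 <= u -> 0 <= v -> 0 < u + v -> 0 < p -> 0 < q ->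
  exists s, u * exp (- p * s) + v * exp (- q * s) = 1.
Proof.
  intros hu hv huv hp hq.
  set (f := fun s => u * exp (- p * s) + v * exp (- q * s)).
  assert (Hlo : exists s, 1 <= f s).
  { assert (G : forall w r, 0 < w -> 0 < r -> w * exp (- r * (ln w / r)) = 1).
    { intros w r hw hr. replace (- r * (ln w / r)) with (- ln w) by (field; lra).
      rewrite exp_Ropp, exp_ln by exact hw. apply Rinv_r; lra. }
    destruct (Rle_lt_or_eq_dec 0 u hu) as [H|H].
    - exists (ln u / p). unfold f. rewrite G by assumption.
      pose proof (exp_pos (- q * (ln u / p))). nra.
    - exists (ln v / q). unfold f. rewrite (G v) by lra.
      pose proof (exp_pos (- p * (ln v / q))). nra. }
  destruct Hlo as [s0 H0].
  destruct (exp_tail u p (1/4) hu hp ltac:(lra)) as [M1 H1].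
  destruct (exp_tail v q (1/4) hv hq ltac:(lra)) as [M2 H2].
  set (s1 := Rmax M1 M2).
  assert (f s1 < 1). { unfold f. specialize (H1 s1 (Rmax_l _ _)). specialize (H2 s1 (Rmax_r _ _)). lra. }
  destruct (IVT_gen f s0 s1 1) as [s [_ Hs]].
  - intros s. unfold f. apply derivable_continuous_pt.
    apply ex_derive_Reals_0. auto_derive; trivial.
  - rewrite Rmin_right by lra. rewrite Rmax_left by lra. lra.
  - exists s; exact Hs.
Qed.

Lemma C2_nonzero (z : C2) : z <> zero -> 0 < (Cmod (fst z))² + (Cmod (snd z))².
Proof.
  intros hz.
  pose proof (Rle_0_sqr (Cmod (fst z))); pose proof (Rle_0_sqr (Cmod (snd z))).
  destruct (Req_dec ((Cmod (fst z))² + (Cmod (snd z))²) 0) as [E|E]; [|lra].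
  exfalso; apply hz; destruct z as [x y]; simpl in *.
  change (@zero C2) with (RtoC 0, RtoC 0).
  f_equal; apply Cmod_eq_0, Rsqr_eq_0; lra.
Qed.

Definition Gauduchon_Ornea_potential (a b : C) (Phi : C2 -> R) : Prop :=
  forall z : C2, z <> zero ->
    0 < Phi z /\
    (Cmod (fst z))² * Rpower (Phi z) (- (2 * ln (Cmod a) / (ln (Cmod a) + ln (Cmod b))))
    + (Cmod (snd z))² * Rpower (Phi z) (- (2 * ln (Cmod b) / (ln (Cmod a) + ln (Cmod b))))
    = 1.

Lemma Gauduchon_Ornea_potential_exists (a b : C) : 1 < Cmod a -> 1 < Cmod b ->
  exists Phi, Gauduchon_Ornea_potential a b Phi.
Proof.
  intros ha hb.
  assert (0 < ln (Cmod a)) by (rewrite <- ln_1; apply ln_increasing; lra).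
  assert (0 < ln (Cmod b)) by (rewrite <- ln_1; apply ln_increasing; lra).
  assert (K : forall z : C2, exists r, z <> zero -> 0 < r /\
    (Cmod (fst z))² * Rpower r (- (2 * ln (Cmod a) / (ln (Cmod a) + ln (Cmod b))))
    + (Cmod (snd z))² * Rpower r (- (2 * ln (Cmod b) / (ln (Cmod a) + ln (Cmod b)))) = 1).
  { intros z; destruct (classic (z = zero)) as [E|E]; [exists 0; contradiction|].
    destruct (potential_eq_exists ((Cmod (fst z))²) ((Cmod (snd z))²)
      (2 * ln (Cmod a) / (ln (Cmod a) + ln (Cmod b))) (2 * ln (Cmod b) / (ln (Cmod a) + ln (Cmod b)))) as [s Hs].
    1,2: apply Rle_0_sqr. apply C2_nonzero, E.
    1,2: apply Rdiv_lt_0_compat; lra.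
    exists (exp s); intros _; split; [apply exp_pos|]. unfold Rpower; rewrite ln_exp; exact Hs. }
  destruct (choice _ K) as [Phi HPhi]. exists Phi; exact HPhi.
Qed.
Lemma Gauduchon_Ornea_potential_unique (a b : C) (Phi Psi : C2 -> R) :
  1 < Cmod a -> 1 < Cmod b ->
  Gauduchon_Ornea_potential a b Phi -> Gauduchon_Ornea_potential a b Psi ->
  forall z, z <> zero -> Phi z = Psi z.
Proof.
  intros ha hb HPhi HPsi z hz.
  assert (0 < ln (Cmod a)) by (rewrite <- ln_1; apply ln_increasing; lra).
  assert (0 < ln (Cmod b)) by (rewrite <- ln_1; apply ln_increasing; lra).
  destruct (HPhi z hz) as [p1 e1], (HPsi z hz) as [p2 e2].
  apply ln_inv; [exact p1 | exact p2 |].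
  apply (potential_eq_unique ((Cmod (fst z))²) ((Cmod (snd z))²)
    (2 * ln (Cmod a) / (ln (Cmod a) + ln (Cmod b)))
    (2 * ln (Cmod b) / (ln (Cmod a) + ln (Cmod b)))); try apply Rle_0_sqr;
    try apply (C2_nonzero z hz); try (apply Rdiv_lt_0_compat; lra); assumption.
Qed.

Definition H_classical (N : dim) (lambda : C) : Type :=
  Hopf (Cn_NormedModule N) (fun z => scal lambda z).

Definition sqnorm {N : dim} (z : Cn_NormedModule N) : R := (norm z)².

Definition classical_parameter (lambda : C) : Prop :=
  lambda <> RtoC 0 /\ Cmod lambda <> 1.

Definition lck_immersion_near (a b : C) (Phi : C2 -> R) (N : dim) (lambda : C)
  (x : H_lin a b) : Prop :=
  exists (U : H_lin a b -> Prop) (F : H_lin a b -> H_classical N lambda),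
    Hopf_open U /\ U x /\ lck_immersion_on U F (lck_form sqnorm) (lck_form Phi).

Definition local_lck_immersion (a b : C) (Phi : C2 -> R) (N : dim) (lambda : C) : Prop :=
  forall x : H_lin a b, lck_immersion_near a b Phi N lambda x.

(** The local immersions into H^n_lambda exist and nowhere can the dimension n
    of the ambient space be lowered. *)
Definition full_lck_immersion (a b : C) (Phi : C2 -> R) (n : nat) (lambda : C) : Prop :=
  local_lck_immersion a b Phi (Some n) lambda /\
  forall (m : nat) (x : H_lin a b), (m < n)%nat ->
    ~ lck_immersion_near a b Phi (Some m) lambda x.

(* Main.v *)
(* On the slice [z_2 = 1] the potential is [Phi = exp s] with
   [|z_1|^2 = exp (A s) - exp ((A - B) s)], [A + B = 2], [A >= B], and when [A > B] the
   coefficient of [|z_1|^4] in [Phi] is negative.  A local immersion [f] gives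
   [4 |d_1 f|^2 / |f|^2 = Delta_{z_1} Phi / Phi], which is radial in [z_1].  By Cauchy's theorem
   the mean of [|f|^2] over [|z_1| = r] is [|f_0|^2 + r^2 |f_1|^2 + o(r^2)], while the mean of
   [|d_1 f|^2] is at least [|f_1|^2]; together with the radial identity this contradicts the
   negative coefficient.  When [|alpha| = |beta|], [Phi = |z|^2] and the inclusion of a
   fundamental annulus is an immersion; in C^1 the differential would have a kernel. *)

Require Import Defs.
From Stdlib Require Import Reals Lra Lia Classical ClassicalChoice.
From Coquelicot Require Import Coquelicot.
Open Scope R_scope.

(** * The real inner product of C^N *)


(** Were power series available, averaging [|d_1 f|^2 = W |f|^2] over circles, where [W] is a
    quarter of the Laplacian of [Phi] in [z_1] divided by [Phi], would show that the mean of [|f|^2]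
    is a constant multiple of [Phi] on the slice; the [z_1^2] coefficient of [f] would then have
    negative squared norm. But [f] is only complex differentiable, with values in a possibly
    infinite-dimensional space, and [d_1 f] is not known to be continuous or even integrable. So the
    argument stays at first order: the second coefficient of [f] is discarded by its sign, which
    leaves one inequality between the two means. That inequality needs Cauchy's theorem only for the
    scalar functions obtained by pairing the first-order Taylor remainder with fixed vectors, and
    Goursat's bisection gives it from differentiability at each point. The criterion concerns the
    moduli because the equation for [Phi] contains [alpha] and [beta] only through [|alpha|] and
    [|beta|]. *)

Definition re_dot (u v : C) : R := fst u * fst v + snd u * snd v.

Lemma Cmod_sqr (u : C) : (Cmod u)² = re_dot u u.
Proof.
  unfold Cmod, re_dot; rewrite Rsqr_sqrt; [ring|].
  apply Rplus_le_le_0_compat; apply pow2_ge_0.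
Qed.

(** Real part of the Hermitian product that is linear in [x]; its imaginary part is
    [rip x (Cn_scal N Ci y)], so a complex scalar appears below as a pair of such reals. *)
Definition rip {N : dim} (x y : Cn N) : R :=
  Series (fun k => re_dot (coord x k) (coord y k)).

Section RealInnerProduct.

Context {N : dim}.
Implicit Types x y z : Cn N.

Lemma ex_series_rip x y : ex_series (fun k => re_dot (coord x k) (coord y k)).
Proof.
  apply (ex_series_le (V := R_CompleteNormedModule) _
    (fun k => sqmod (coord x) k + sqmod (coord y) k)).
  - intros k; change (norm ?a) with (Rabs a).
    unfold sqmod; rewrite !Cmod_sqr; unfold re_dot.
    set (a := fst (coord x k)); set (b := snd (coord x k)).
    set (c := fst (coord y k)); set (d := snd (coord y k)).
    pose proof (Rle_0_sqr (a - c)); pose proof (Rle_0_sqr (a + c)).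
    pose proof (Rle_0_sqr (b - d)); pose proof (Rle_0_sqr (b + d)).
    pose proof (Rle_0_sqr a); pose proof (Rle_0_sqr b).
    pose proof (Rle_0_sqr c); pose proof (Rle_0_sqr d).
    unfold Rsqr in *; apply Rabs_le; lra.
  - apply ex_series_Rplus; apply coord_summable.
Qed.

Lemma rip_sym x y : rip x y = rip y x.
Proof. apply Series_ext; intros k; unfold re_dot; ring. Qed.

Lemma rip_plus_l x y z : rip (Cn_plus N x y) z = rip x z + rip y z.
Proof.
  unfold rip; rewrite <- Series_plus by apply ex_series_rip.
  apply Series_ext; intros k; unfold re_dot; simpl; ring.
Qed.

Lemma rip_opp_l x z : rip (Cn_opp N x) z = - rip x z.
Proof.
  unfold rip; rewrite <- Series_opp.
  apply Series_ext; intros k; unfold re_dot; simpl; ring.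
Qed.

Lemma rip_scal_l (c : C) x z :
  rip (Cn_scal N c x) z = fst c * rip x z + snd c * rip (Cn_scal N Ci x) z.
Proof.
  unfold rip; rewrite <- !Series_scal_l, <- Series_plus.
  - apply Series_ext; intros k; unfold re_dot; simpl; ring.
  - apply ex_series_Rmult, ex_series_rip.
  - apply ex_series_Rmult, (ex_series_rip (Cn_scal N Ci x)).
Qed.

Lemma rip_Ci_Ci x z : rip (Cn_scal N Ci x) (Cn_scal N Ci z) = rip x z.
Proof. apply Series_ext; intros k; unfold re_dot; simpl; ring. Qed.

Lemma rip_Ci_l x z : rip (Cn_scal N Ci x) z = - rip x (Cn_scal N Ci z).
Proof.
  unfold rip; rewrite <- Series_opp.
  apply Series_ext; intros k; unfold re_dot; simpl; ring.
Qed.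

Lemma rip_plus_r x y z : rip z (Cn_plus N x y) = rip z x + rip z y.
Proof. rewrite !(rip_sym z); apply rip_plus_l. Qed.

Lemma rip_opp_r x z : rip z (Cn_opp N x) = - rip z x.
Proof. rewrite !(rip_sym z); apply rip_opp_l. Qed.

Lemma rip_scal_r (c : C) x z :
  rip z (Cn_scal N c x) = fst c * rip z x + snd c * rip z (Cn_scal N Ci x).
Proof. rewrite !(rip_sym z); apply rip_scal_l. Qed.

Lemma rip_self_Ci x : rip x (Cn_scal N Ci x) = 0.
Proof. pose proof (rip_Ci_l x x) as H; rewrite rip_sym in H; lra. Qed.

Lemma rip_scal_scal (c : C) x z :
  rip (Cn_scal N c x) (Cn_scal N c z) = (Cmod c)² * rip x z.
Proof.
  rewrite rip_scal_l, !(rip_scal_r c), rip_Ci_Ci, rip_Ci_l, Cmod_sqr; unfold re_dot; ring.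
Qed.

Lemma rip_self x : rip x x = (Cn_norm N x)².
Proof.
  rewrite Cn_norm_sqr; apply Series_ext; intros k; unfold sqmod; rewrite Cmod_sqr; reflexivity.
Qed.

Lemma rip_ge0 x : 0 <= rip x x.
Proof. rewrite rip_self; apply Rle_0_sqr. Qed.

Lemma rip_eq0 x : rip x x = 0 -> x = Cn_zero N.
Proof. rewrite rip_self; intros H; apply Cn_norm_eq0, Rsqr_eq_0, H. Qed.

(** Cauchy-Schwarz, read off by squaring the triangle inequality. *)
Lemma rip_le_norm x y : rip x y <= Cn_norm N x * Cn_norm N y.
Proof.
  pose proof (Cn_norm_triangle N x y) as H.
  apply Rsqr_incr_1 in H.
  2: apply Cn_norm_ge0.
  2: apply Rplus_le_le_0_compat; apply Cn_norm_ge0.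
  rewrite <- rip_self, rip_plus_l, !rip_plus_r, (rip_sym y x), !rip_self in H.
  unfold Rsqr in H; nra.
Qed.

Lemma Rabs_rip_le x y : Rabs (rip x y) <= Cn_norm N x * Cn_norm N y.
Proof.
  apply Rabs_le; split; [|apply rip_le_norm].
  pose proof (rip_le_norm (Cn_opp N x) y) as H.
  rewrite rip_opp_l, Cn_norm_opp in H; lra.
Qed.

Lemma rip_le_half x y : rip x y <= (rip x x + rip y y) / 2.
Proof.
  pose proof (rip_ge0 (Cn_plus N x (Cn_opp N y))) as H.
  rewrite rip_plus_l, !rip_plus_r, !rip_opp_l, !rip_opp_r, (rip_sym y x) in H; lra.
Qed.

End RealInnerProduct.

(** * Goursat's theorem on rectangles *)

Section RectangleIntegral.

Variables P Q : R -> R -> R.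

(** The form [P ds + Q dt] is closed at the point: [k] is both the [t]-derivative of [P] and the
    [s]-derivative of [Q]. Nothing is asked about continuity of the derivatives, which is the
    situation of Goursat's theorem. *)
Definition closed_at (s t : R) : Prop :=
  exists ps k qt, differentiable_pt_lim P s t ps k /\ differentiable_pt_lim Q s t k qt.

Definition closed_on (a b c d : R) : Prop :=
  forall s t, a <= s <= b -> c <= t <= d -> closed_at s t.

Definition boundary_integral (a b c d : R) : R :=
  RInt (fun s => P s c) a b + RInt (fun t => Q b t) c d
  - RInt (fun s => P s d) a b - RInt (fun t => Q a t) c d.

Lemma differentiable_pt_lim_partial_l (F : R -> R -> R) s t u v :
  differentiable_pt_lim F s t u v -> is_derive (fun s => F s t) s u.
Proof.
  intros H; apply is_derive_Reals.
  replace u with (u * 1 + v * 0) by ring.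
  apply (derivable_pt_lim_comp_2d F (fun s => s) (fun _ => t) s u v 1 0 H).
  - apply derivable_pt_lim_id.
  - apply derivable_pt_lim_const.
Qed.

Lemma differentiable_pt_lim_partial_r (F : R -> R -> R) s t u v :
  differentiable_pt_lim F s t u v -> is_derive (fun t => F s t) t v.
Proof.
  intros H; apply is_derive_Reals.
  replace v with (u * 0 + v * 1) by ring.
  apply (derivable_pt_lim_comp_2d F (fun _ => s) (fun t => t) t u v 0 1 H).
  - apply derivable_pt_lim_const.
  - apply derivable_pt_lim_id.
Qed.

Lemma closed_ex_RInt_P a b c d t : closed_on a b c d -> a <= b -> c <= t <= d ->
  forall a' b', a <= a' <= b -> a <= b' <= b -> ex_RInt (fun s => P s t) a' b'.
Proof.
  intros H hab ht a' b' ha hb; apply (ex_RInt_continuous (V := R_CompleteNormedModule)).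
  intros s hs; assert (hs' : a <= s <= b).
  { revert hs; unfold Rmin, Rmax; destruct (Rle_dec a' b'); lra. }
  destruct (H s t hs' ht) as (ps & k & qt & H1 & _).
  apply (ex_derive_continuous (K := R_AbsRing) (V := R_NormedModule)); exists ps.
  apply (differentiable_pt_lim_partial_l _ _ _ _ _ H1).
Qed.

Lemma closed_ex_RInt_Q a b c d s : closed_on a b c d -> c <= d -> a <= s <= b ->
  forall c' d', c <= c' <= d -> c <= d' <= d -> ex_RInt (fun t => Q s t) c' d'.
Proof.
  intros H hcd hs c' d' hc hd; apply (ex_RInt_continuous (V := R_CompleteNormedModule)).
  intros t ht; assert (ht' : c <= t <= d).
  { revert ht; unfold Rmin, Rmax; destruct (Rle_dec c' d'); lra. }
  destruct (H s t hs ht') as (ps & k & qt & _ & H1).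
  apply (ex_derive_continuous (K := R_AbsRing) (V := R_NormedModule)); exists qt.
  apply (differentiable_pt_lim_partial_r _ _ _ _ _ H1).
Qed.

Lemma boundary_integral_split a m b c n d : closed_on a b c d ->
  a <= m <= b -> c <= n <= d ->
  boundary_integral a b c d =
  boundary_integral a m c n + boundary_integral m b c n
  + boundary_integral a m n d + boundary_integral m b n d.
Proof.
  intros H hm hn; unfold boundary_integral.
  assert (KP : forall t, c <= t <= d -> RInt (fun s => P s t) a b =
    RInt (fun s => P s t) a m + RInt (fun s => P s t) m b).
  { intros t ht; symmetry; apply (RInt_Chasles (V := R_CompleteNormedModule));
      apply (closed_ex_RInt_P a b c d t H); lra. }
  assert (KQ : forall s, a <= s <= b -> RInt (fun t => Q s t) c d =
    RInt (fun t => Q s t) c n + RInt (fun t => Q s t) n d).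
  { intros s hs; symmetry; apply (RInt_Chasles (V := R_CompleteNormedModule));
      apply (closed_ex_RInt_Q a b c d s H); lra. }
  rewrite !KP, !KQ by lra; ring.
Qed.

(** An affine form whose cross derivatives share the value [k] integrates to zero, so only the
    remainders count: four sides of length at most [h], each with error at most [eps * h]. *)
Lemma boundary_integral_local a b c d x y ps k qt h eps :
  closed_on a b c d -> a <= x <= b -> c <= y <= d ->
  b - a <= h -> d - c <= h -> 0 <= eps ->
  (forall s t, a <= s <= b -> c <= t <= d ->
     Rabs (P s t - P x y - (ps * (s - x) + k * (t - y))) <= eps * h) ->
  (forall s t, a <= s <= b -> c <= t <= d ->
     Rabs (Q s t - Q x y - (k * (s - x) + qt * (t - y))) <= eps * h) ->
  Rabs (boundary_integral a b c d) <= 4 * eps * h².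
Proof.
  intros H hx hy hb hd he HP HQ.
  assert (EP1 : ex_RInt (fun s => P s c) a b) by (apply (closed_ex_RInt_P a b c d c H); lra).
  assert (EP2 : ex_RInt (fun s => P s d) a b) by (apply (closed_ex_RInt_P a b c d d H); lra).
  assert (EQ1 : ex_RInt (fun t => Q a t) c d) by (apply (closed_ex_RInt_Q a b c d a H); lra).
  assert (EQ2 : ex_RInt (fun t => Q b t) c d) by (apply (closed_ex_RInt_Q a b c d b H); lra).
  (* Opposite sides are paired, which removes [ps] and [qt]. The constants subtracted in [f] and [g]
     integrate to [k * (c - d) * (b - a)] and to its negative. *)
  set (f := fun s => minus (minus (P s c) (P s d)) (k * (c - d))).
  set (g := fun t => minus (minus (Q b t) (Q a t)) (k * (b - a))).
  assert (Ef0 : ex_RInt (fun s => minus (P s c) (P s d)) a b)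
    by (apply (ex_RInt_minus (V := R_NormedModule)); assumption).
  assert (Eg0 : ex_RInt (fun t => minus (Q b t) (Q a t)) c d)
    by (apply (ex_RInt_minus (V := R_NormedModule)); assumption).
  assert (Ef : ex_RInt f a b)
    by (apply (ex_RInt_minus (V := R_NormedModule)); [assumption | apply ex_RInt_const]).
  assert (Eg : ex_RInt g c d)
    by (apply (ex_RInt_minus (V := R_NormedModule)); [assumption | apply ex_RInt_const]).
  assert (E : boundary_integral a b c d = RInt f a b + RInt g c d).
  { unfold boundary_integral, f, g.
    rewrite !(RInt_minus (V := R_CompleteNormedModule)), !RInt_const
      by (assumption || apply ex_RInt_const).
    unfold minus, plus, opp, scal; simpl; unfold mult; simpl.
    change (RInt (Q b) c d) with (RInt (fun t => Q b t) c d).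
    change (RInt (Q a) c d) with (RInt (fun t => Q a t) c d). ring. }
  rewrite E.
  assert (Bf : Rabs (RInt f a b) <= (b - a) * (2 * (eps * h))).
  { apply abs_RInt_le_const; [lra | exact Ef |]. intros s hs.
    replace (f s) with ((P s c - P x y - (ps * (s - x) + k * (c - y)))
      - (P s d - P x y - (ps * (s - x) + k * (d - y))))
      by (unfold f, minus, plus, opp; simpl; ring).
    pose proof (HP s c ltac:(lra) ltac:(lra)) as H1.
    pose proof (HP s d ltac:(lra) ltac:(lra)) as H2.
    revert H1 H2; unfold Rabs; repeat destruct Rcase_abs; lra. }
  assert (Bg : Rabs (RInt g c d) <= (d - c) * (2 * (eps * h))).
  { apply abs_RInt_le_const; [lra | exact Eg |]. intros t ht.
    replace (g t) with ((Q b t - Q x y - (k * (b - x) + qt * (t - y)))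
      - (Q a t - Q x y - (k * (a - x) + qt * (t - y))))
      by (unfold g, minus, plus, opp; simpl; ring).
    pose proof (HQ b t ltac:(lra) ltac:(lra)) as H1.
    pose proof (HQ a t ltac:(lra) ltac:(lra)) as H2.
    revert H1 H2; unfold Rabs; repeat destruct Rcase_abs; lra. }
  pose proof (Rabs_triang (RInt f a b) (RInt g c d)) as HT.
  assert (0 <= h) by lra.
  assert (0 <= eps * h) by nra.
  assert ((b - a) * (2 * (eps * h)) <= h * (2 * (eps * h))) by (apply Rmult_le_compat_r; lra).
  assert ((d - c) * (2 * (eps * h)) <= h * (2 * (eps * h))) by (apply Rmult_le_compat_r; lra).
  unfold Rsqr; nra.
Qed.

End RectangleIntegral.

(** Serves each coordinate of the corners in the bisection: the intervals are nested, and the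
    supremum of the left ends lies in all of them. *)
Lemma nested_halves (a : nat -> R) (w : R) : 0 <= w ->
  (forall n, a n <= a (S n) <= a n + w / 2 ^ S n) ->
  exists x, forall n, a n <= x <= a n + w / 2 ^ n.
Proof.
  intros hw H.
  assert (W : forall n, 0 <= w / 2 ^ n).
  { intros n; apply Rdiv_le_0_compat; [exact hw | apply pow_lt; lra]. }
  assert (W2 : forall n, w / 2 ^ n = 2 * (w / 2 ^ S n)).
  { intros n; simpl; field; apply pow_nonzero; lra. }
  assert (UP : forall m n, a (n + m)%nat + w / 2 ^ (n + m) <= a n + w / 2 ^ n).
  { induction m as [|m IH]; intros n; [rewrite Nat.add_0_r; lra|].
    specialize (IH n); rewrite Nat.add_succ_r.
    pose proof (H (n + m)%nat) as K; rewrite (W2 (n + m)%nat) in IH; lra. }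
  assert (LO : forall m n, a n <= a (n + m)%nat).
  { induction m as [|m IH]; intros n; [rewrite Nat.add_0_r; lra|].
    specialize (IH n); rewrite Nat.add_succ_r; pose proof (H (n + m)%nat); lra. }
  assert (UB : forall m n, a m <= a n + w / 2 ^ n).
  { intros m n; destruct (Nat.le_gt_cases m n) as [K|K].
    - replace n with (m + (n - m))%nat by lia.
      pose proof (LO (n - m)%nat m); pose proof (W (m + (n - m))%nat); lra.
    - replace m with (n + (m - n))%nat by lia.
      pose proof (UP (m - n)%nat n); pose proof (W (n + (m - n))%nat); lra. }
  destruct (completeness (fun y => exists n, y = a n)) as [x [Hx1 Hx2]].
  - exists (a 0%nat + w / 2 ^ 0); intros y [n ->]; apply UB.
  - exists (a 0%nat); exists 0%nat; reflexivity.
  - exists x; intros n; split.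
    + apply Hx1; exists n; reflexivity.
    + apply Hx2; intros y [m ->]; apply UB.
Qed.

(* Goursat: bisect the rectangle, keeping a quarter with at least a fourth of the
   integral; the limit point contradicts differentiability unless the integral vanishes. *)
Lemma boundary_integral_closed (P Q : R -> R -> R) (a0 b0 c0 d0 : R) :
  a0 <= b0 -> c0 <= d0 -> closed_on P Q a0 b0 c0 d0 ->
  boundary_integral P Q a0 b0 c0 d0 = 0.
Proof.
  intros hab hcd H.
  set (w := b0 - a0); set (h := d0 - c0).
  set (J := fun (p : R * R) n => boundary_integral P Q
    (fst p) (fst p + w / 2 ^ n) (snd p) (snd p + h / 2 ^ n)).
  set (inside := fun (p : R * R) n => a0 <= fst p /\ fst p + w / 2 ^ n <= b0
    /\ c0 <= snd p /\ snd p + h / 2 ^ n <= d0).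
  assert (Wn : forall n, 0 <= w / 2 ^ n).
  { intros n; apply Rdiv_le_0_compat; [unfold w; lra | apply pow_lt; lra]. }
  assert (Hn : forall n, 0 <= h / 2 ^ n).
  { intros n; apply Rdiv_le_0_compat; [unfold h; lra | apply pow_lt; lra]. }
  assert (W2 : forall n, w / 2 ^ n = w / 2 ^ S n + w / 2 ^ S n).
  { intros n; simpl; field; apply pow_nonzero; lra. }
  assert (H2 : forall n, h / 2 ^ n = h / 2 ^ S n + h / 2 ^ S n).
  { intros n; simpl; field; apply pow_nonzero; lra. }
  assert (Step : forall p n, exists q,
    fst p <= fst q <= fst p + w / 2 ^ S n /\ snd p <= snd q <= snd p + h / 2 ^ S n /\
    (inside p n -> Rabs (J p n) <= 4 * Rabs (J q (S n)))).
  { intros [a c] n.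
    set (m := a + w / 2 ^ S n); set (k := c + h / 2 ^ S n).
    pose proof (Wn (S n)); pose proof (Hn (S n)); pose proof (W2 n); pose proof (H2 n).
    destruct (classic (inside (a, c) n)) as [I|I].
    (* A rectangle that leaves the initial one carries no claim, so its own corner is returned;
       [choice] needs a total statement. *)
    2: { exists (a, c); simpl fst; simpl snd; repeat split; try lra; contradiction. }
    assert (Hsub : closed_on P Q a (a + w / 2 ^ n) c (c + h / 2 ^ n)).
    { destruct I as (I1 & I2 & I3 & I4); simpl fst in *; simpl snd in *.
      intros s t hs ht; apply H; lra. }
    pose proof (boundary_integral_split P Q a m (a + w / 2 ^ n) c k (c + h / 2 ^ n) Hsub
      ltac:(unfold m; lra) ltac:(unfold k; lra)) as E.
    replace (a + w / 2 ^ n) with (m + w / 2 ^ S n) in E at 2 3 by (unfold m; lra).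
    replace (c + h / 2 ^ n) with (k + h / 2 ^ S n) in E at 2 3 by (unfold k; lra).
    change (boundary_integral P Q a (a + w / 2 ^ n) c (c + h / 2 ^ n)) with (J (a, c) n) in E.
    change (boundary_integral P Q a m c k) with (J (a, c) (S n)) in E.
    change (boundary_integral P Q m (m + w / 2 ^ S n) c k) with (J (m, c) (S n)) in E.
    change (boundary_integral P Q a m k (k + h / 2 ^ S n)) with (J (a, k) (S n)) in E.
    change (boundary_integral P Q m (m + w / 2 ^ S n) k (k + h / 2 ^ S n))
      with (J (m, k) (S n)) in E.
    assert (T : Rabs (J (a, c) n) <= Rabs (J (a, c) (S n)) + Rabs (J (m, c) (S n))
      + Rabs (J (a, k) (S n)) + Rabs (J (m, k) (S n))).
    { rewrite E; unfold Rabs; repeat destruct Rcase_abs; lra. }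
    destruct (Rle_dec (Rabs (J (a, c) n)) (4 * Rabs (J (a, c) (S n)))) as [K1|K1].
    { exists (a, c); simpl fst; simpl snd; repeat split; lra. }
    destruct (Rle_dec (Rabs (J (a, c) n)) (4 * Rabs (J (m, c) (S n)))) as [K2|K2].
    { exists (m, c); simpl fst; simpl snd; unfold m at 1 2; repeat split; lra. }
    destruct (Rle_dec (Rabs (J (a, c) n)) (4 * Rabs (J (a, k) (S n)))) as [K3|K3].
    { exists (a, k); simpl fst; simpl snd; unfold k at 1 2; repeat split; lra. }
    exists (m, k); simpl fst; simpl snd; unfold k at 1 2, m at 1 2; repeat split; lra. }
  destruct (choice (fun (pn : (R * R) * nat) q =>
    fst (fst pn) <= fst q <= fst (fst pn) + w / 2 ^ S (snd pn) /\
    snd (fst pn) <= snd q <= snd (fst pn) + h / 2 ^ S (snd pn) /\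
    (inside (fst pn) (snd pn) -> Rabs (J (fst pn) (snd pn)) <= 4 * Rabs (J q (S (snd pn))))))
    as [next Hnext].
  { intros [p n]; apply (Step p n). }
  set (seq := fix seq n := match n with O => (a0, c0) | S n => next (seq n, n) end).
  assert (Hseq : forall n,
    fst (seq n) <= fst (seq (S n)) <= fst (seq n) + w / 2 ^ S n /\
    snd (seq n) <= snd (seq (S n)) <= snd (seq n) + h / 2 ^ S n /\
    (inside (seq n) n -> Rabs (J (seq n) n) <= 4 * Rabs (J (seq (S n)) (S n)))).
  { intros n; apply (Hnext (seq n, n)). }
  assert (Hin : forall n, inside (seq n) n).
  { induction n as [|n IH].
    - unfold inside; simpl; unfold w, h; lra.
    - destruct IH as (I1 & I2 & I3 & I4); destruct (Hseq n) as (S1 & S2 & _).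
      rewrite (W2 n) in I2; rewrite (H2 n) in I4; unfold inside; lra. }
  assert (HJ : forall n, Rabs (J (seq 0%nat) 0%nat) <= 4 ^ n * Rabs (J (seq n) n)).
  { induction n as [|n IH]; [simpl; lra|].
    destruct (Hseq n) as (_ & _ & S3); specialize (S3 (Hin n)).
    apply (Rle_trans _ _ _ IH); simpl (4 ^ S n).
    pose proof (pow_lt 4 n ltac:(lra)); nra. }
  assert (E0 : boundary_integral P Q a0 b0 c0 d0 = J (seq 0%nat) 0%nat).
  { unfold J; simpl; unfold w, h; f_equal; field. }
  destruct (nested_halves (fun n => fst (seq n)) w) as [x Hx];
    [unfold w; lra | intros n; apply (Hseq n) |].
  destruct (nested_halves (fun n => snd (seq n)) h) as [y Hy];
    [unfold h; lra | intros n; apply (Hseq n) |].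
  assert (Hxy : closed_at P Q x y).
  { apply H; [specialize (Hx 0%nat) | specialize (Hy 0%nat)]; simpl in *; unfold w, h in *; lra. }
  destruct Hxy as (ps & k & qt & DP & DQ).
  set (l := Rmax w h).
  assert (hl : w <= l /\ h <= l) by (split; [apply Rmax_l | apply Rmax_r]).
  assert (hl0 : 0 <= l) by (unfold w in *; lra).
  (* At level [n] the sides are at most [l / 2 ^ n], so the local bound is [4 * eps * l² / 4 ^ n],
     and the factor [4 ^ n] of [HJ] cancels exactly. *)
  assert (Main : forall eps : posreal,
    Rabs (boundary_integral P Q a0 b0 c0 d0) <= 4 * eps * l²).
  { intros eps.
    destruct (DP eps) as [dP HP]; destruct (DQ eps) as [dQ HQ].
    set (dd := Rmin dP dQ).
    assert (hdd : 0 < dd) by (apply Rmin_pos; apply cond_pos).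
    destruct (Rle_or_lt l 0) as [Hl|Hl].
    { assert (El : l = 0) by lra.
      assert (Ew : w = 0) by (unfold w in *; lra). assert (Eh : h = 0) by (unfold h in *; lra).
      assert (Ea : b0 = a0) by (unfold w in Ew; lra). assert (Ec : d0 = c0) by (unfold h in Eh; lra).
      rewrite Ea, Ec; unfold boundary_integral; rewrite !RInt_point.
      unfold zero; simpl; rewrite El; unfold Rsqr.
      replace (0 + 0 - 0 - 0) with 0 by ring; rewrite Rabs_R0; lra. }
    destruct (pow_lt_1_zero (/2) ltac:(rewrite Rabs_pos_eq; lra) (dd / l)
      ltac:(apply Rdiv_lt_0_compat; lra)) as [n Hn0].
    specialize (Hn0 n (le_n n)).
    assert (p2 : 0 < 2 ^ n) by (apply pow_lt; lra).
    assert (hn : l / 2 ^ n < dd).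
    { rewrite Rabs_pos_eq in Hn0 by (apply pow_le; lra).
      rewrite pow_inv in Hn0. apply (Rmult_lt_compat_r l) in Hn0; [|exact Hl].
      replace (dd / l * l) with dd in Hn0 by (field; lra).
      unfold Rdiv; lra. }
    assert (wn : w / 2 ^ n <= l / 2 ^ n)
      by (apply Rmult_le_compat_r; [apply Rlt_le, Rinv_0_lt_compat; exact p2 | tauto]).
    assert (hhn : h / 2 ^ n <= l / 2 ^ n)
      by (apply Rmult_le_compat_r; [apply Rlt_le, Rinv_0_lt_compat; exact p2 | tauto]).
    pose proof (Hx n) as Hxn; pose proof (Hy n) as Hyn; simpl in Hxn, Hyn.
    destruct (Hin n) as (I1 & I2 & I3 & I4).
    assert (B : Rabs (J (seq n) n) <= 4 * eps * (l / 2 ^ n)²).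
    { assert (dPl : dd <= dP) by apply Rmin_l. assert (dQl : dd <= dQ) by apply Rmin_r.
      assert (M : forall s t, fst (seq n) <= s <= fst (seq n) + w / 2 ^ n ->
        snd (seq n) <= t <= snd (seq n) + h / 2 ^ n ->
        Rabs (s - x) <= l / 2 ^ n /\ Rabs (t - y) <= l / 2 ^ n).
      { intros s t hs ht; split; apply Rabs_le; lra. }
      apply (boundary_integral_local P Q _ _ _ _ x y ps k qt); try lra.
      - intros s t hs ht; apply H; lra.
      - apply Rlt_le, cond_pos.
      - intros s t hs ht; destruct (M s t hs ht) as [M1 M2].
        eapply Rle_trans; [apply HP; lra|].
        apply Rmult_le_compat_l; [apply Rlt_le, cond_pos | apply Rmax_lub; assumption].
      - intros s t hs ht; destruct (M s t hs ht) as [M1 M2].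
        eapply Rle_trans; [apply HQ; lra|].
        apply Rmult_le_compat_l; [apply Rlt_le, cond_pos | apply Rmax_lub; assumption]. }
    rewrite E0; apply (Rle_trans _ _ _ (HJ n)).
    apply (Rmult_le_compat_l (4 ^ n)) in B; [|apply pow_le; lra].
    apply (Rle_trans _ _ _ B); apply Req_le; unfold Rsqr.
    replace (4 ^ n) with (2 ^ n * 2 ^ n)
      by (rewrite <- Rpow_mult_distr; f_equal; ring).
    field; lra. }
  destruct (Req_dec (boundary_integral P Q a0 b0 c0 d0) 0) as [E|E]; [exact E|exfalso].
  apply Rabs_pos_lt in E.
  set (v := Rabs (boundary_integral P Q a0 b0 c0 d0)) in *.
  (* With this [eps] the bound becomes [v * l² / (2 * (l² + 1))], which is below [v]; the summand 1
     keeps the denominator positive when [l = 0]. *)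
  assert (Hpos : 0 < v / (8 * (l² + 1))).
  { apply Rdiv_lt_0_compat; [exact E|]; pose proof (Rle_0_sqr l); lra. }
  specialize (Main (mkposreal _ Hpos)); simpl in Main.
  pose proof (Rle_0_sqr l).
  assert (4 * (v / (8 * (l² + 1))) * l² = v * (l² / (2 * (l² + 1)))) by (field; lra).
  assert (l² / (2 * (l² + 1)) < 1).
  { apply (Rmult_lt_reg_r (2 * (l² + 1))); [lra|].
    unfold Rdiv; rewrite Rmult_assoc, Rinv_l; lra. }
  nra.
Qed.

(** * Circle means of holomorphic functions *)


Lemma differentiable_pt_lim_Rmult x y : differentiable_pt_lim Rmult x y y x.
Proof.
  intros eps; exists eps; intros u v hu hv.
  replace (u * v - x * y - (y * (u - x) + x * (v - y))) with ((u - x) * (v - y)) by ring.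
  rewrite Rabs_mult; apply Rmult_le_compat; try apply Rabs_pos; [lra | apply Rmax_r].
Qed.

Lemma differentiable_pt_lim_lin (a b x y : R) :
  differentiable_pt_lim (fun u v => a * u + b * v) x y a b.
Proof.
  intros eps; exists (mkposreal 1 Rlt_0_1); intros u v _ _.
  replace (a * u + b * v - (a * x + b * y) - (a * (u - x) + b * (v - y))) with 0 by ring.
  rewrite Rabs_R0; apply Rmult_le_pos; [apply Rlt_le, cond_pos|].
  apply Rle_trans with (2 := Rmax_l _ _), Rabs_pos.
Qed.

Lemma differentiable_pt_lim_proj2_0 (f : R -> R) x y l :
  derivable_pt_lim f y l -> differentiable_pt_lim (fun _ v => f v) x y 0 l.
Proof.
  intros H eps; destruct (H eps (cond_pos eps)) as [d Hd]; exists d; intros u v _ hv.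
  replace (f v - f y - (0 * (u - x) + l * (v - y))) with (f v - f y - l * (v - y)) by ring.
  destruct (Req_dec (v - y) 0) as [E|E].
  { replace v with y by lra.
    replace (f y - f y - l * (y - y)) with 0 by ring.
    rewrite Rabs_R0; apply Rmult_le_pos; [apply Rlt_le, cond_pos|].
    apply Rle_trans with (2 := Rmax_l _ _), Rabs_pos. }
  specialize (Hd (v - y) E hv); replace (y + (v - y)) with v in Hd by ring.
  replace (f v - f y - l * (v - y)) with (((f v - f y) / (v - y) - l) * (v - y)) by (field; lra).
  rewrite Rabs_mult; apply Rmult_le_compat; try apply Rabs_pos; [lra | apply Rmax_r].
Qed.

(** [u + i v] is complex differentiable at [s + i t]. *)
Definition CR (u v : R -> R -> R) (s t : R) : Prop :=
  exists a b, differentiable_pt_lim u s t a (- b) /\ differentiable_pt_lim v s t b a.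

(** [v ds + u dt] is the imaginary part of [(u + i v) d(s + i t)]. This choice puts the real part
    [u] on the sides where [s] is fixed, which are the circles. *)
Lemma CR_closed u v s t : CR u v s t -> closed_at v u s t.
Proof. intros (a & b & Hu & Hv); exists b, a, (- b); split; assumption. Qed.

Lemma CR_mult u1 v1 u2 v2 s t : CR u1 v1 s t -> CR u2 v2 s t ->
  CR (fun s t => u1 s t * u2 s t - v1 s t * v2 s t)
     (fun s t => u1 s t * v2 s t + v1 s t * u2 s t) s t.
Proof.
  intros (a & b & Hu1 & Hv1) (c & d & Hu2 & Hv2).
  pose proof (differentiable_pt_lim_comp Rmult u1 u2 _ _ _ _ _ _ _ _
    (differentiable_pt_lim_Rmult _ _) Hu1 Hu2) as Huu.
  pose proof (differentiable_pt_lim_comp Rmult v1 v2 _ _ _ _ _ _ _ _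
    (differentiable_pt_lim_Rmult _ _) Hv1 Hv2) as Hvv.
  pose proof (differentiable_pt_lim_comp Rmult u1 v2 _ _ _ _ _ _ _ _
    (differentiable_pt_lim_Rmult _ _) Hu1 Hv2) as Huv.
  pose proof (differentiable_pt_lim_comp Rmult v1 u2 _ _ _ _ _ _ _ _
    (differentiable_pt_lim_Rmult _ _) Hv1 Hu2) as Hvu.
  pose proof (differentiable_pt_lim_comp _ _ _ _ _ _ _ _ _ _ _
    (differentiable_pt_lim_lin 1 (- 1) _ _) Huu Hvv) as Hre.
  pose proof (differentiable_pt_lim_comp _ _ _ _ _ _ _ _ _ _ _
    (differentiable_pt_lim_lin 1 1 _ _) Huv Hvu) as Him.
  exists (a * u2 s t + u1 s t * c - (b * v2 s t + v1 s t * d)),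
    (u1 s t * d + a * v2 s t + (v1 s t * c + b * u2 s t)); split.
  - match type of Hre with differentiable_pt_lim _ _ _ ?l ?m =>
      replace (a * u2 s t + u1 s t * c - (b * v2 s t + v1 s t * d)) with l by ring;
      replace (- (u1 s t * d + a * v2 s t + (v1 s t * c + b * u2 s t))) with m by ring end.
    apply differentiable_pt_lim_ext with (2 := Hre).
    exists (mkposreal 1 Rlt_0_1); intros; ring.
  - match type of Him with differentiable_pt_lim _ _ _ ?l ?m =>
      replace (a * u2 s t + u1 s t * c - (b * v2 s t + v1 s t * d)) with m by ring;
      replace (u1 s t * d + a * v2 s t + (v1 s t * c + b * u2 s t)) with l by ring end.
    apply differentiable_pt_lim_ext with (2 := Him).
    exists (mkposreal 1 Rlt_0_1); intros; ring.
Qed.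

Lemma CR_comp u v x y s t : CR u v (x s t) (y s t) -> CR x y s t ->
  CR (fun s t => u (x s t) (y s t)) (fun s t => v (x s t) (y s t)) s t.
Proof.
  intros (a & b & Hu & Hv) (c & d & Hx & Hy).
  pose proof (differentiable_pt_lim_comp _ _ _ _ _ _ _ _ _ _ _ Hu Hx Hy) as H1.
  pose proof (differentiable_pt_lim_comp _ _ _ _ _ _ _ _ _ _ _ Hv Hx Hy) as H2.
  exists (a * c - b * d), (b * c + a * d).
  replace (a * c - b * d) with (a * c + - b * d) at 1 by ring.
  replace (- (b * c + a * d)) with (a * - d + - b * c) by ring.
  replace (a * c - b * d) with (b * - d + a * c) by ring.
  split; assumption.
Qed.

(** The function [exp (k (s + i t))]: for [k = 1] it is [z] in logarithmic polar coordinates, for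
    [k = -1] it is [1 / z], the factor that isolates the first Fourier mode. *)
Lemma CR_exp (k s t : R) :
  CR (fun s t => exp (k * s) * cos (k * t)) (fun s t => exp (k * s) * sin (k * t)) s t.
Proof.
  assert (He : differentiable_pt_lim (fun s _ => exp (k * s)) s t (k * exp (k * s)) 0).
  { apply (differentiable_pt_lim_proj1_0 (fun s => exp (k * s))), is_derive_Reals.
    auto_derive; [trivial | ring]. }
  assert (Hc : differentiable_pt_lim (fun _ t => cos (k * t)) s t 0 (- k * sin (k * t))).
  { apply (differentiable_pt_lim_proj2_0 (fun t => cos (k * t))), is_derive_Reals.
    auto_derive; [trivial | ring]. }
  assert (Hs : differentiable_pt_lim (fun _ t => sin (k * t)) s t 0 (k * cos (k * t))).
  { apply (differentiable_pt_lim_proj2_0 (fun t => sin (k * t))), is_derive_Reals.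
    auto_derive; [trivial | ring]. }
  pose proof (differentiable_pt_lim_comp _ _ _ _ _ _ _ _ _ _ _
    (differentiable_pt_lim_Rmult _ _) He Hc) as H1.
  pose proof (differentiable_pt_lim_comp _ _ _ _ _ _ _ _ _ _ _
    (differentiable_pt_lim_Rmult _ _) He Hs) as H2.
  exists (k * (exp (k * s) * cos (k * t))), (k * (exp (k * s) * sin (k * t))); split.
  - match type of H1 with differentiable_pt_lim _ _ _ ?l ?m =>
      replace (k * (exp (k * s) * cos (k * t))) with l by ring;
      replace (- (k * (exp (k * s) * sin (k * t)))) with m by ring end; exact H1.
  - match type of H2 with differentiable_pt_lim _ _ _ ?l ?m =>
      replace (k * (exp (k * s) * cos (k * t))) with m by ring;
      replace (k * (exp (k * s) * sin (k * t))) with l by ring end; exact H2.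
Qed.

(* The vertical sides of the rectangle [s', s] x [0, 2 pi] cancel by periodicity, so the mean
   does not depend on [s]. *)
Lemma circle_mean_zero (u v : R -> R -> R) (s1 : R) :
  (forall s t, s <= s1 -> CR u v s t) ->
  (forall s, v s (2 * PI) = v s 0) ->
  (forall eps, 0 < eps -> exists S, forall s t, s <= S -> Rabs (u s t) <= eps) ->
  is_RInt (u s1) 0 (2 * PI) 0.
Proof.
  intros HCR Hper Hlim; pose proof PI_RGT_0 as hpi.
  assert (HC : forall s, s <= s1 -> closed_on v u s s1 0 (2 * PI)).
  { intros s hs x t hx ht; apply CR_closed, HCR; lra. }
  assert (Ex : forall s, s <= s1 -> ex_RInt (u s) 0 (2 * PI)).
  { intros s hs; apply (closed_ex_RInt_Q v u s s1 0 (2 * PI) s (HC s hs)); lra. }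
  replace 0 with (RInt (u s1) 0 (2 * PI)) at 2.
  { apply (RInt_correct (V := R_CompleteNormedModule)), Ex; lra. }
  assert (K : forall s, s <= s1 -> RInt (u s1) 0 (2 * PI) = RInt (u s) 0 (2 * PI)).
  { intros s hs.
    pose proof (boundary_integral_closed v u s s1 0 (2 * PI) hs ltac:(lra) (HC s hs)) as E.
    unfold boundary_integral in E.
    rewrite (RInt_ext (fun x => v x (2 * PI)) (fun x => v x 0)) in E by (intros; apply Hper).
    change (RInt (u s1) 0 (2 * PI)) with (RInt (fun t => u s1 t) 0 (2 * PI)).
    change (RInt (u s) 0 (2 * PI)) with (RInt (fun t => u s t) 0 (2 * PI)). lra. }
  destruct (Req_dec (RInt (u s1) 0 (2 * PI)) 0) as [E|E]; [exact E | exfalso].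
  apply Rabs_pos_lt in E; set (m := Rabs (RInt (u s1) 0 (2 * PI))) in *.
  (* Over length [2 * PI] this bound integrates to [m / 2], too small for an integral of absolute
     value [m]. *)
  destruct (Hlim (m / (4 * PI)) ltac:(apply Rdiv_lt_0_compat; lra)) as [S HS].
  set (s := Rmin S s1).
  assert (h1 : s <= s1) by apply Rmin_r. assert (h2 : s <= S) by apply Rmin_l.
  assert (B : m <= (2 * PI - 0) * (m / (4 * PI))).
  { unfold m at 1; rewrite (K s h1).
    apply abs_RInt_le_const; [lra | apply Ex, h1 | intros t _; apply HS, h2]. }
  replace ((2 * PI - 0) * (m / (4 * PI))) with (m / 2) in B by (field; lra). lra.
Qed.

Definition polar (r t : R) : C := (r * cos t, r * sin t).

Lemma Cmod_polar r t : 0 <= r -> Cmod (polar r t) = r.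
Proof.
  intros hr; unfold Cmod, polar; simpl.
  replace (r * cos t * (r * cos t * 1) + r * sin t * (r * sin t * 1))
    with (r² * ((sin t)² + (cos t)²)) by (unfold Rsqr; ring).
  rewrite sin2_cos2, Rmult_1_r; apply sqrt_Rsqr, hr.
Qed.

(** * Holomorphic maps of one variable into C^N, paired with fixed vectors *)

Section Holomorphic.

Context {N : dim}.

Definition hol_at (f : C -> Cn N) (z : C) (l : Cn N) : Prop :=
  forall eps, 0 < eps -> exists d, 0 < d /\ forall k, Cmod k < d ->
    Cn_norm N (Cn_plus N (f (Cplus z k)) (Cn_opp N (Cn_plus N (f z) (Cn_scal N k l))))
      <= eps * Cmod k.

(** Pairing with a fixed [y] commutes with differentiation. The derivative in the imaginary
    direction is [rip (i l) y], written as [- rip l (i y)] to display the Cauchy-Riemann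
    equations. *)
Lemma hol_at_rip f z l y : hol_at f z l ->
  differentiable_pt_lim (fun a b => rip (f (a, b)) y) (fst z) (snd z)
    (rip l y) (- rip l (Cn_scal N Ci y)).
Proof.
  intros H eps.
  (* [M] bounds the norm of [y] and stays positive when [y = 0]; the factor 2 in [eps / (2 * M)]
     pays for comparing [Cmod] with the maximum norm. *)
  set (M := Cn_norm N y + 1).
  assert (hM : 0 < M) by (pose proof (Cn_norm_ge0 N y); unfold M; lra).
  destruct (H (eps / (2 * M))) as (d & hd & Hd).
  { apply Rdiv_lt_0_compat; [apply cond_pos | lra]. }
  assert (hd2 : 0 < d / 2) by lra.
  exists (mkposreal _ hd2); simpl; intros u v hu hv.
  set (k := (u - fst z, v - snd z) : C).
  assert (Ez : (u, v) = Cplus z k) by (unfold k, Cplus; simpl; f_equal; ring).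
  set (m := Rmax (Rabs (u - fst z)) (Rabs (v - snd z))).
  assert (hk : Cmod k <= 2 * m).
  { eapply Rle_trans; [apply Cmod_2Rmax|]; simpl; fold m.
    apply Rmult_le_compat_r.
    - apply Rle_trans with (2 := Rmax_l _ _), Rabs_pos.
    - replace 2 with (sqrt (2 * 2)) at 2 by (apply sqrt_square; lra).
      apply sqrt_le_1_alt; lra. }
  assert (hkd : Cmod k < d).
  { apply (Rle_lt_trans _ _ _ hk); assert (m < d / 2) by (apply Rmax_lub_lt; assumption); lra. }
  specialize (Hd k hkd); rewrite <- Ez in Hd.
  assert (E : rip (f (u, v)) y - rip (f (fst z, snd z)) y
     - (rip l y * (u - fst z) + - rip l (Cn_scal N Ci y) * (v - snd z))
     = rip (Cn_plus N (f (u, v)) (Cn_opp N (Cn_plus N (f z) (Cn_scal N k l)))) y).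
  { rewrite rip_plus_l, rip_opp_l, rip_plus_l, rip_scal_l, rip_Ci_l, <- surjective_pairing.
    unfold k; simpl; ring. }
  rewrite E; eapply Rle_trans; [apply Rabs_rip_le|].
  apply Rle_trans with ((eps / (2 * M) * Cmod k) * M).
  - apply Rmult_le_compat; try apply Cn_norm_ge0; [exact Hd | unfold M; lra].
  - replace (eps / (2 * M) * Cmod k * M) with (eps * (Cmod k / 2)) by (field; lra).
    apply Rmult_le_compat_l; [apply Rlt_le, cond_pos | lra].
Qed.

(** The Hermitian product of [f] with a fixed vector is a scalar holomorphic function; this reduces
    vector-valued Cauchy theory to the scalar case. *)
Lemma hol_at_CR f z l y : hol_at f z l ->
  CR (fun a b => rip (f (a, b)) y) (fun a b => rip (f (a, b)) (Cn_scal N Ci y))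
    (fst z) (snd z).
Proof.
  intros H; exists (rip l y), (rip l (Cn_scal N Ci y)); split; [apply hol_at_rip, H|].
  pose proof (hol_at_rip f z l (Cn_scal N Ci y) H) as K.
  rewrite <- rip_Ci_l, rip_Ci_Ci in K; exact K.
Qed.

Lemma hol_at_rip_polar f r t l y : hol_at f (polar r t) l ->
  is_derive (fun t => rip (f (polar r t)) y) t
    (rip l y * (- r * sin t) - rip l (Cn_scal N Ci y) * (r * cos t)).
Proof.
  intros H; apply is_derive_Reals; apply hol_at_rip with (y := y) in H.
  unfold Rminus; rewrite Ropp_mult_distr_l.
  apply (derivable_pt_lim_comp_2d (fun a b => rip (f (a, b)) y)
    (fun t => r * cos t) (fun t => r * sin t)); [exact H| |];
    apply is_derive_Reals; auto_derive; trivial; ring.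
Qed.

Lemma hol_at_sub_affine f z l a b : hol_at f z l ->
  hol_at (fun z => Cn_plus N (f z) (Cn_opp N (Cn_plus N a (Cn_scal N z b)))) z
    (Cn_plus N l (Cn_opp N b)).
Proof.
  intros H eps he; destruct (H eps he) as (d & hd & Hd); exists d; split; [exact hd|].
  intros k hk; specialize (Hd k hk).
  match goal with |- Cn_norm N ?x <= _ => match type of Hd with Cn_norm N ?y <= _ =>
    replace x with y; [exact Hd|] end end.
  apply Cn_ext; intros j; simpl; ring.
Qed.

(** In the coordinate [z = exp (s + i t)] both the Hermitian product of [f] with [y] and its
    quotient by [z] are holomorphic. Since [f = o(|z|)], both tend to 0 as [s] goes to minus
    infinity, so [circle_mean_zero] applies. The intended [f] is a first-order Taylor remainder. *)
Lemma circle_means (f : C -> Cn N) (R0 r : R) (y : Cn N) :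
  0 < r < R0 ->
  (forall z, 0 < Cmod z < R0 -> exists l, hol_at f z l) ->
  (forall eps, 0 < eps -> exists d, 0 < d /\ forall z, Cmod z < d ->
     Cn_norm N (f z) <= eps * Cmod z) ->
  is_RInt (fun t => rip (f (polar r t)) y) 0 (2 * PI) 0 /\
  is_RInt (fun t => cos t * rip (f (polar r t)) y
                    + sin t * rip (f (polar r t)) (Cn_scal N Ci y)) 0 (2 * PI) 0.
Proof.
  intros hr Hhol Ho.
  set (x0 := fun s t : R => exp (1 * s) * cos (1 * t)).
  set (y0 := fun s t : R => exp (1 * s) * sin (1 * t)).
  set (u := fun s t => rip (f (x0 s t, y0 s t)) y).
  set (v := fun s t => rip (f (x0 s t, y0 s t)) (Cn_scal N Ci y)).
  set (x1 := fun s t : R => exp (-1 * s) * cos (-1 * t)).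
  set (y1 := fun s t : R => exp (-1 * s) * sin (-1 * t)).
  assert (Epol : forall s t, (x0 s t, y0 s t) = polar (exp s) t).
  { intros s t; unfold x0, y0, polar; rewrite !Rmult_1_l; reflexivity. }
  assert (HCR : forall s t, s <= ln r -> CR u v s t).
  { intros s t hs.
    assert (hz : 0 < Cmod (x0 s t, y0 s t) < R0).
    { rewrite Epol, Cmod_polar by (apply Rlt_le, exp_pos); split; [apply exp_pos|].
      apply Rle_lt_trans with r; [|lra].
      rewrite <- (exp_ln r) by lra.
      destruct hs as [hs| ->]; [apply Rlt_le, exp_increasing, hs | apply Rle_refl]. }
    destruct (Hhol _ hz) as [l Hl].
    apply (CR_comp (fun a b => rip (f (a, b)) y)
      (fun a b => rip (f (a, b)) (Cn_scal N Ci y)) x0 y0).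
    - apply (hol_at_CR f (x0 s t, y0 s t) l y Hl).
    - apply CR_exp. }
  assert (Hsmall : forall eps, 0 < eps -> exists S, forall s t, s <= S ->
    Cn_norm N (f (x0 s t, y0 s t)) <= eps * exp s).
  { intros eps he; destruct (Ho eps he) as (d & hd & Hd).
    exists (ln (d / 2)); intros s t hs.
    rewrite <- (Cmod_polar (exp s) t), Epol by (apply Rlt_le, exp_pos).
    apply Hd; rewrite Cmod_polar by (apply Rlt_le, exp_pos).
    apply Rle_lt_trans with (exp (ln (d / 2))).
    - destruct hs as [hs| ->]; [apply Rlt_le, exp_increasing, hs | apply Rle_refl].
    - rewrite exp_ln; lra. }
  set (M := Cn_norm N y + 1).
  assert (hM : 0 < M) by (pose proof (Cn_norm_ge0 N y); unfold M; lra).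
  assert (Hbound : forall c eps s t, Cn_norm N (f (x0 s t, y0 s t)) <= eps / M * exp s ->
    0 < eps -> Cmod c <= 1 ->
    Rabs (rip (f (x0 s t, y0 s t)) (Cn_scal N c y)) <= eps * exp s).
  { intros c eps s t B he hc; eapply Rle_trans; [apply Rabs_rip_le|].
    rewrite Cn_norm_scal; pose proof (Cn_norm_ge0 N y); pose proof (Cmod_ge_0 c).
    apply Rle_trans with (eps / M * exp s * M).
    - apply Rmult_le_compat; [apply Cn_norm_ge0 | nra | exact B | unfold M; nra].
    - apply Req_le; field; lra. }
  split.
  - apply (is_RInt_ext (u (ln r))).
    { intros t _; unfold u; rewrite Epol, exp_ln by lra; reflexivity. }
    apply (circle_mean_zero u v).
    + exact HCR.
    + intros s; unfold v; rewrite !Epol; unfold polar.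
      rewrite cos_2PI, sin_2PI, cos_0, sin_0; reflexivity.
    + intros eps he; destruct (Hsmall (eps / M)) as [S HS];
        [apply Rdiv_lt_0_compat; assumption|].
      (* The bound 0 on [s] gives [exp s <= 1], which absorbs the factor in [Hbound]. *)
      exists (Rmin S 0); intros s t hs.
      specialize (HS s t (Rle_trans _ _ _ hs (Rmin_l _ _))).
      pose proof (Hbound (RtoC 1) eps s t HS he ltac:(rewrite Cmod_1; lra)) as B.
      replace (Cn_scal N (RtoC 1) y) with y in B by (apply Cn_ext; intros j; simpl; ring).
      apply (Rle_trans _ _ _ B).
      assert (exp s <= 1).
      { rewrite <- exp_0; pose proof (Rle_trans _ _ _ hs (Rmin_r _ _)) as [K| ->];
          [apply Rlt_le, exp_increasing, K | apply Rle_refl]. }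
      nra.
  - assert (Eprod : forall s t, u s t * x1 s t - v s t * y1 s t
      = exp (- s) * rip (f (x0 s t, y0 s t)) (Cn_scal N (cos t, sin t) y)).
    { intros s t; rewrite rip_scal_r; unfold u, v, x1, y1; simpl.
      replace (-1 * s) with (- s) by ring; replace (-1 * t) with (- t) by ring.
      rewrite cos_neg, sin_neg; ring. }
    (* The real part of the quotient by [z] carries a factor [1 / r], undone by this scaling. *)
    apply (is_RInt_ext (fun t => scal r (u (ln r) t * x1 (ln r) t - v (ln r) t * y1 (ln r) t))).
    { intros t _; rewrite Eprod, Epol, exp_ln, rip_scal_r, exp_Ropp, exp_ln by lra.
      unfold scal; simpl; unfold mult; simpl; field; lra. }
    replace 0 with (scal r 0) at 2 by (unfold scal; simpl; unfold mult; simpl; ring).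
    apply (is_RInt_scal (V := R_NormedModule)).
    apply (circle_mean_zero (fun s t => u s t * x1 s t - v s t * y1 s t)
      (fun s t => u s t * y1 s t + v s t * x1 s t)).
    + intros s t hs; apply CR_mult; [apply HCR, hs | apply CR_exp].
    + intros s; unfold u, v; rewrite !Epol; unfold polar, x1, y1.
      replace (-1 * (2 * PI)) with (- (2 * PI)) by ring.
      replace (-1 * 0) with 0 by ring.
      rewrite cos_neg, sin_neg, cos_2PI, sin_2PI, cos_0, sin_0, Ropp_0; reflexivity.
    + intros eps he; destruct (Hsmall (eps / M)) as [S HS];
        [apply Rdiv_lt_0_compat; assumption|].
      exists S; intros s t hs; rewrite Eprod, Rabs_mult.
      rewrite (Rabs_pos_eq (exp (- s))) by (apply Rlt_le, exp_pos).
      assert (hc : Cmod (cos t, sin t) <= 1).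
      { replace (cos t, sin t) with (polar 1 t) by (unfold polar; f_equal; ring).
        rewrite Cmod_polar; lra. }
      pose proof (Hbound (cos t, sin t) eps s t (HS s t hs) he hc) as B.
      apply Rle_trans with (exp (- s) * (eps * exp s)).
      * apply Rmult_le_compat_l; [apply Rlt_le, exp_pos | exact B].
      * apply Req_le; rewrite exp_Ropp; field; apply Rgt_not_eq, exp_pos.
Qed.

End Holomorphic.

(** A substitute for integrating [dq], which may fail to be integrable: in the application it
    contains [f']. The mean value theorem for [q] minus the integral of the continuous lower bound
    [l] is enough. *)
Lemma RInt_le_increment (q dq l : R -> R) (a b : R) : a <= b ->
  (forall t, a <= t <= b -> is_derive q t (dq t)) ->
  (forall t, continuous l t) ->
  (forall t, a <= t <= b -> l t <= dq t) ->
  RInt l a b <= q b - q a.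
Proof.
  intros hab Hq Hl Hle.
  assert (HI : forall t, is_derive (fun x => RInt l a x) t (l t)).
  { intros t; apply (is_derive_RInt (V := R_NormedModule)) with a; [|apply Hl].
    exists (mkposreal 1 Rlt_0_1); intros x _.
    apply (RInt_correct (V := R_CompleteNormedModule)),
      (ex_RInt_continuous (V := R_CompleteNormedModule)); intros; apply Hl. }
  assert (HD : forall t, a <= t <= b ->
    is_derive (fun x => minus (q x) (RInt l a x)) t (minus (dq t) (l t))).
  { intros t ht; apply (is_derive_minus (V := R_NormedModule)); [apply Hq, ht | apply HI]. }
  destruct (MVT_gen (fun x => minus (q x) (RInt l a x)) a b (fun t => minus (dq t) (l t)))
    as (c & hc & E).
  - rewrite Rmin_left, Rmax_right by lra; intros t ht; apply HD; lra.
  - rewrite Rmin_left, Rmax_right by lra; intros t ht.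
    apply derivable_continuous_pt, ex_derive_Reals_0; eexists; apply HD; lra.
  - rewrite Rmin_left, Rmax_right in hc by lra.
    rewrite RInt_point in E; unfold minus, plus, opp, zero in E; simpl in E.
    specialize (Hle c hc).
    change (RInt l a b) with (RInt (fun t => l t) a b) in *. nra.
Qed.


Lemma is_RInt_lin4 (f1 f2 f3 f4 : R -> R) (a b c0 c1 c2 c3 c4 : R) :
  is_RInt f1 a b 0 -> is_RInt f2 a b 0 -> is_RInt f3 a b 0 -> is_RInt f4 a b 0 ->
  is_RInt (fun t => c0 + c1 * f1 t + c2 * f2 t + c3 * f3 t + c4 * f4 t) a b ((b - a) * c0).
Proof.
  intros H1 H2 H3 H4.
  pose proof (is_RInt_const (V := R_NormedModule) a b c0) as H0.
  pose proof (is_RInt_plus (V := R_NormedModule) _ _ _ _ _ _ H0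
    (is_RInt_scal (V := R_NormedModule) f1 a b c1 0 H1)) as K1.
  pose proof (is_RInt_plus (V := R_NormedModule) _ _ _ _ _ _ K1
    (is_RInt_scal (V := R_NormedModule) f2 a b c2 0 H2)) as K2.
  pose proof (is_RInt_plus (V := R_NormedModule) _ _ _ _ _ _ K2
    (is_RInt_scal (V := R_NormedModule) f3 a b c3 0 H3)) as K3.
  pose proof (is_RInt_plus (V := R_NormedModule) _ _ _ _ _ _ K3
    (is_RInt_scal (V := R_NormedModule) f4 a b c4 0 H4)) as K4.
  replace ((b - a) * c0)
    with ((b - a) * c0 + c1 * 0 + c2 * 0 + c3 * 0 + c4 * 0) by ring.
  exact K4.
Qed.

Lemma is_RInt_cos_2PI : is_RInt cos 0 (2 * PI) 0.
Proof.
  replace 0 with (minus (sin (2 * PI)) (sin 0)) at 2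
    by (rewrite sin_2PI, sin_0; unfold minus, plus, opp; simpl; ring).
  apply (is_RInt_derive (V := R_CompleteNormedModule) sin cos); intros x _.
  - auto_derive; [trivial | ring].
  - apply (ex_derive_continuous (K := R_AbsRing) (V := R_NormedModule)); auto_derive; trivial.
Qed.

Lemma is_RInt_sin_2PI : is_RInt sin 0 (2 * PI) 0.
Proof.
  replace 0 with (minus (- cos (2 * PI)) (- cos 0)) at 2
    by (rewrite cos_2PI, cos_0; unfold minus, plus, opp; simpl; ring).
  apply (is_RInt_derive (V := R_CompleteNormedModule) (fun x => - cos x) sin); intros x _.
  - auto_derive; [trivial | ring].
  - apply (ex_derive_continuous (K := R_AbsRing) (V := R_NormedModule)); auto_derive; trivial.
Qed.

(* With [R z = f z - f 0 - z f'(0)], the circle means of [<R, f 0>] and [<R, z f'(0)>] vanish,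
   so the mean of [|f|^2] is [|f 0|^2 + r^2 |f'(0)|^2 + o(r^2)].  On the other hand
   [Re <i f, e^{it} f'(0)>] is periodic in [t] with derivative
   [Re <f, e^{it} f'(0)> - r Re <f', f'(0)>], so [|f'(0)|^2] is at most the mean of [|f'|^2]. *)
Lemma derivative_norm_bound {N : dim} (f f' : C -> Cn N) (W : R -> R) (R0 : R) :
  0 < R0 ->
  (forall z, Cmod z < R0 -> hol_at f z (f' z)) ->
  (forall z, Cmod z < R0 -> rip (f' z) (f' z) = W (Cmod z) * rip (f z) (f z)) ->
  (forall r, 0 < r < R0 -> 0 <= W r) ->
  forall eps, 0 < eps -> exists d, 0 < d /\ forall r, 0 < r < d ->
    rip (f' (RtoC 0)) (f' (RtoC 0)) <= W r *
      (rip (f (RtoC 0)) (f (RtoC 0)) + (rip (f' (RtoC 0)) (f' (RtoC 0)) + eps) * r²).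
Proof.
  intros hR Hhol Hnorm HW eps heps; pose proof PI_RGT_0 as hpi.
  set (f0 := f (RtoC 0)) in *; set (f1 := f' (RtoC 0)) in *.
  set (g := fun z => Cn_plus N (f z) (Cn_opp N (Cn_plus N f0 (Cn_scal N z f1)))).
  assert (Hg : forall z, Cmod z < R0 -> hol_at g z (Cn_plus N (f' z) (Cn_opp N f1))).
  { intros z hz; apply hol_at_sub_affine, Hhol, hz. }
  assert (Hg0 : forall e, 0 < e -> exists d, 0 < d /\ forall z, Cmod z < d ->
     Cn_norm N (g z) <= e * Cmod z).
  { intros e he; destruct (Hhol (RtoC 0) ltac:(rewrite Cmod_0; exact hR) e he) as (d & hd & Hd).
    exists d; split; [exact hd|]; intros z hz; specialize (Hd z hz).
    rewrite Cplus_0_l in Hd; exact Hd. }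
  assert (hse : 0 < sqrt eps) by (apply sqrt_lt_R0, heps).
  (* The remainder enters [|f|^2] through its square, so [sqrt eps] yields [eps * r²]. *)
  destruct (Hg0 (sqrt eps) hse) as (d & hd & Hd).
  exists (Rmin d R0); split; [apply Rmin_pos; assumption|]; intros r hr.
  assert (hrd : r < d) by (pose proof (Rmin_l d R0); lra).
  assert (hrR : 0 < r < R0) by (pose proof (Rmin_r d R0); lra).
  set (A0 := rip f0 f0); set (A1 := rip f1 f1).
  set (k1 := rip f0 f1); set (k2 := rip f0 (Cn_scal N Ci f1)).
  set (a := fun t => rip (g (polar r t)) f0).
  set (b1 := fun t => rip (g (polar r t)) f1).
  set (b2 := fun t => rip (g (polar r t)) (Cn_scal N Ci f1)).
  set (b := fun t => cos t * b1 t + sin t * b2 t).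
  assert (hz : forall t, Cmod (polar r t) = r) by (intros t; apply Cmod_polar; lra).
  destruct (circle_means g R0 r f0 hrR) as [Ia _];
    [intros z hz'; eexists; apply Hg; lra | exact Hg0 |].
  destruct (circle_means g R0 r f1 hrR) as [_ Ib];
    [intros z hz'; eexists; apply Hg; lra | exact Hg0 |].
  fold a in Ia.
  assert (Hrem : forall t, rip (g (polar r t)) (g (polar r t)) <= eps * r²).
  { intros t; specialize (Hd (polar r t) ltac:(rewrite hz; lra)); rewrite hz in Hd.
    rewrite rip_self; apply Rsqr_incr_1 in Hd; [| apply Cn_norm_ge0 | nra].
    rewrite Rsqr_mult, Rsqr_sqrt in Hd by lra; exact Hd. }
  assert (Edec : forall z, f z = Cn_plus N (Cn_plus N f0 (Cn_scal N z f1)) (g z)).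
  { intros z; apply Cn_ext; intros j; unfold g; simpl; ring. }
  assert (Hff : forall t, rip (f (polar r t)) (f (polar r t)) <=
    A0 + (A1 + eps) * r² + 2 * r * (cos t * k1 + sin t * k2) + 2 * a t + 2 * r * b t).
  { intros t; specialize (Hrem t); unfold a, b, b1, b2 in *.
    rewrite (Edec (polar r t)).
    set (G := g (polar r t)) in *.
    rewrite !rip_plus_l, !rip_plus_r, rip_scal_scal, hz, !(rip_sym _ G),
      (rip_sym (Cn_scal N _ f1) f0), !(rip_scal_r (polar r t)).
    unfold polar; simpl; fold A0 A1 k1 k2; lra. }
  set (F1 := fun t => rip (f (polar r t)) f1).
  set (F2 := fun t => rip (f (polar r t)) (Cn_scal N Ci f1)).
  assert (Hp : forall t, cos t * F1 t + sin t * F2 t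
    = r * A1 + (cos t * k1 + sin t * k2) + b t).
  { intros t; unfold F1, F2, b, b1, b2.
    rewrite (Edec (polar r t)), !rip_plus_l, !(rip_scal_l (polar r t)), rip_Ci_Ci.
    rewrite (rip_Ci_l f1 f1), !rip_self_Ci.
    unfold polar; simpl; fold A1 k1 k2.
    pose proof (sin2_cos2 t) as E; unfold Rsqr in E.
    replace (r * A1) with (r * A1 * (sin t * sin t + cos t * cos t)) by (rewrite E; ring).
    ring. }
  set (w := W r).
  (* Lower bound for [q'], from [rip f' f1 <= (|f'|^2 + |f1|^2) / 2], then [|f'|^2 = w |f|^2], then
     [Hff]. It is arranged so that every term except the constant has mean zero. *)
  set (l := fun t => (r * A1 - r / 2 * (w * (A0 + (A1 + eps) * r²) + A1))
    + (1 - w * r²) * k1 * cos t + (1 - w * r²) * k2 * sin t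
    + (- r * w) * a t + (1 - w * r²) * b t).
  set (q := fun t => sin t * F1 t - cos t * F2 t).
  set (L1 := fun t => rip (f' (polar r t)) f1).
  set (L2 := fun t => rip (f' (polar r t)) (Cn_scal N Ci f1)).
  assert (Il : is_RInt l 0 (2 * PI)
    ((2 * PI - 0) * (r * A1 - r / 2 * (w * (A0 + (A1 + eps) * r²) + A1)))).
  { apply is_RInt_lin4;
      [apply is_RInt_cos_2PI | apply is_RInt_sin_2PI | exact Ia | exact Ib]. }
  assert (Dq : forall t, is_derive q t (cos t * F1 t + sin t * F2 t - r * L1 t)).
  { intros t.
    assert (D1 : is_derive F1 t (L1 t * (- r * sin t) - L2 t * (r * cos t)))
      by (apply (hol_at_rip_polar f r t (f' (polar r t)) f1), Hhol; rewrite hz; lra).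
    assert (D2 : is_derive F2 t (L2 t * (- r * sin t) + L1 t * (r * cos t))).
    { replace (L1 t) with (- rip (f' (polar r t)) (Cn_scal N Ci (Cn_scal N Ci f1))).
      2: { unfold L1; rewrite <- rip_Ci_l, rip_Ci_Ci; reflexivity. }
      replace (L2 t * (- r * sin t)
        + - rip (f' (polar r t)) (Cn_scal N Ci (Cn_scal N Ci f1)) * (r * cos t))
        with (L2 t * (- r * sin t)
        - rip (f' (polar r t)) (Cn_scal N Ci (Cn_scal N Ci f1)) * (r * cos t)) by ring.
      apply (hol_at_rip_polar f r t (f' (polar r t)) (Cn_scal N Ci f1)), Hhol; rewrite hz; lra. }
    replace (cos t * F1 t + sin t * F2 t - r * L1 t) with
      ((cos t * F1 t + sin t * (L1 t * (- r * sin t) - L2 t * (r * cos t)))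
       - (- sin t * F2 t + cos t * (L2 t * (- r * sin t) + L1 t * (r * cos t)))).
    2: { pose proof (sin2_cos2 t) as E; unfold Rsqr in E.
         replace (r * L1 t) with (r * L1 t * (sin t * sin t + cos t * cos t))
           by (rewrite E; ring). ring. }
    apply (is_derive_minus (V := R_NormedModule)).
    - apply (is_derive_mult sin F1); [auto_derive; [trivial | ring] | exact D1 | apply Rmult_comm].
    - apply (is_derive_mult cos F2); [auto_derive; [trivial | ring] | exact D2 | apply Rmult_comm]. }
  assert (Cl : forall t, continuous l t).
  { intros t.
    assert (Ha : forall y, ex_derive (fun t => rip (g (polar r t)) y) t).
    { intros y; eexists; apply hol_at_rip_polar, Hg; rewrite hz; lra. }
    pose proof (Ha f0) as Ha0; pose proof (Ha f1) as Ha1.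
    pose proof (Ha (Cn_scal N Ci f1)) as Ha2.
    fold a in Ha0; fold b1 in Ha1; fold b2 in Ha2.
    apply (ex_derive_continuous (K := R_AbsRing) (V := R_NormedModule)).
    unfold l, b; auto_derive; tauto. }
  assert (HL : forall t, 0 <= t <= 2 * PI -> l t <= cos t * F1 t + sin t * F2 t - r * L1 t).
  { intros t _; rewrite Hp.
    pose proof (rip_le_half (f' (polar r t)) f1) as Hh.
    rewrite Hnorm, hz in Hh by (rewrite hz; lra).
    fold w A1 in Hh; fold (L1 t) in Hh.
    pose proof (Rmult_le_compat_l w _ _ (HW r hrR) (Hff t)) as Hw.
    assert (L1 t <= (w * (A0 + (A1 + eps) * r² + 2 * r * (cos t * k1 + sin t * k2)
      + 2 * a t + 2 * r * b t) + A1) / 2) as Hl by lra.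
    apply (Rmult_le_compat_l r) in Hl; [|lra].
    unfold l, Rsqr in *; lra. }
  assert (Hpi2 : 0 <= 2 * PI) by lra.
  pose proof (RInt_le_increment q _ l 0 (2 * PI) Hpi2 (fun t _ => Dq t) Cl HL) as Fin.
  rewrite (is_RInt_unique _ _ _ _ Il) in Fin.
  (* By periodicity the increment of [q] vanishes, so the constant term of [l] is nonpositive;
     divided by [r / 2] this is the claim. *)
  assert (Eq : q (2 * PI) = q 0).
  { unfold q, F1, F2, polar; rewrite sin_2PI, cos_2PI, sin_0, cos_0; reflexivity. }
  rewrite Eq in Fin.
  assert (0 < 2 * PI * (r / 2)) by (apply Rmult_lt_0_compat; lra).
  assert (E : (2 * PI - 0) * (r * A1 - r / 2 * (w * (A0 + (A1 + eps) * r²) + A1))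
    = 2 * PI * (r / 2) * (A1 - w * (A0 + (A1 + eps) * r²))) by field.
  rewrite E in Fin. nra.
Qed.

(** * The potential on a slice *)


Lemma is_derive_bound (f : R -> R) (x l : R) : is_derive f x l ->
  forall eps, 0 < eps -> exists d, 0 < d /\
    forall y, Rabs (y - x) < d -> Rabs (f y - f x - l * (y - x)) <= eps * Rabs (y - x).
Proof.
  intros H eps he; apply is_derive_Reals in H.
  destruct (differentiable_pt_lim_proj1_0 f x 0 l H (mkposreal eps he)) as [d Hd].
  exists d; split; [apply cond_pos|]; intros y hy.
  specialize (Hd y 0 hy ltac:(rewrite Rminus_diag, Rabs_R0; apply cond_pos)); simpl in Hd.
  rewrite Rminus_diag, Rabs_R0, Rmult_0_l, Rplus_0_r in Hd.
  rewrite Rmax_left in Hd by apply Rabs_pos; exact Hd.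
Qed.

Lemma is_derive_of_bound (f : R -> R) (x l : R) :
  (forall eps, 0 < eps -> exists d, 0 < d /\
    forall y, Rabs (y - x) < d -> Rabs (f y - f x - l * (y - x)) <= eps * Rabs (y - x)) ->
  is_derive f x l.
Proof.
  intros H; apply is_derive_Reals; intros eps he.
  destruct (H (eps / 2) ltac:(lra)) as (d & hd & Hd).
  exists (mkposreal d hd); simpl; intros h h0 hh.
  specialize (Hd (x + h)); replace (x + h - x) with h in Hd by ring; specialize (Hd hh).
  replace ((f (x + h) - f x) / h - l) with ((f (x + h) - f x - l * h) / h) by (field; lra).
  unfold Rdiv; rewrite Rabs_mult, Rabs_inv.
  pose proof (Rabs_pos_lt h h0).
  apply Rle_lt_trans with (eps / 2 * Rabs h * / Rabs h).
  - apply Rmult_le_compat_r; [apply Rlt_le, Rinv_0_lt_compat; assumption | exact Hd].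
  - rewrite Rmult_assoc, Rinv_r; lra.
Qed.

(** Implicit differentiation of [K (S u) = p u]. No continuity of [S] is assumed: the lower bound
    [c] on the increments of [K] controls those of [S] by those of [p]. *)
Lemma is_derive_implicit (K p S : R -> R) (t k p' c : R) :
  is_derive K (S t) k -> is_derive p t p' -> 0 < k -> 0 < c ->
  (forall u, K (S u) = p u) ->
  (forall u, c * Rabs (S u - S t) <= Rabs (K (S u) - K (S t))) ->
  is_derive S t (p' / k).
Proof.
  intros HK Hp hk hc E Hinv; apply is_derive_of_bound; intros eps heps.
  (* By [B2] the error of [K] costs at most [k * eps / 2 * |h|], and [e2] bounds the error of [p] by
     the same amount; the 1 in [e2] gives the crude bound [B1]. *)
  set (e1 := k * eps * c / (2 * (Rabs p' + 1))).
  set (e2 := Rmin 1 (k * eps / 2)).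
  pose proof (Rabs_pos p') as hp.
  assert (hke : 0 < k * eps) by (apply Rmult_lt_0_compat; assumption).
  assert (he1 : 0 < e1).
  { apply Rdiv_lt_0_compat; [apply Rmult_lt_0_compat; assumption | lra]. }
  assert (he2 : 0 < e2) by (apply Rmin_pos; lra).
  destruct (is_derive_bound K _ _ HK e1 he1) as (d1 & hd1 & H1).
  destruct (is_derive_bound p _ _ Hp e2 he2) as (d2 & hd2 & H2).
  exists (Rmin d2 (d1 * c / (Rabs p' + 1))); split.
  { apply Rmin_pos; [exact hd2|]. apply Rdiv_lt_0_compat; [nra | lra]. }
  intros u hu.
  assert (hu2 : Rabs (u - t) < d2) by (eapply Rlt_le_trans; [exact hu | apply Rmin_l]).
  assert (hu1 : Rabs (u - t) < d1 * c / (Rabs p' + 1))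
    by (eapply Rlt_le_trans; [exact hu | apply Rmin_r]).
  specialize (H2 u hu2).
  set (h := u - t) in *; pose proof (Rabs_pos h) as hh.
  assert (B1 : Rabs (p u - p t) <= (Rabs p' + 1) * Rabs h).
  { replace (p u - p t) with ((p u - p t - p' * h) + p' * h) by ring.
    eapply Rle_trans; [apply Rabs_triang|]; rewrite Rabs_mult.
    pose proof (Rmult_le_compat_r (Rabs h) e2 1 hh (Rmin_l _ _)); lra. }
  assert (B2 : Rabs (S u - S t) <= (Rabs p' + 1) * Rabs h / c).
  { specialize (Hinv u); rewrite !E in Hinv.
    apply (Rmult_le_reg_l c); [exact hc|].
    replace (c * ((Rabs p' + 1) * Rabs h / c)) with ((Rabs p' + 1) * Rabs h) by (field; lra); lra. }
  assert (B3 : Rabs (S u - S t) < d1).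
  { eapply Rle_lt_trans; [exact B2|].
    apply (Rmult_lt_compat_l (Rabs p' + 1)) in hu1; [|lra].
    replace ((Rabs p' + 1) * (d1 * c / (Rabs p' + 1))) with (d1 * c) in hu1 by (field; lra).
    apply (Rmult_lt_reg_r c); [exact hc|].
    replace ((Rabs p' + 1) * Rabs h / c * c) with ((Rabs p' + 1) * Rabs h) by (field; lra); lra. }
  specialize (H1 (S u) B3); rewrite !E in H1.
  assert (B4 : Rabs (k * (S u - S t) - p' * h) <= k * eps * Rabs h).
  { replace (k * (S u - S t) - p' * h) with
      ((p u - p t - p' * h) + - (p u - p t - k * (S u - S t))) by ring.
    eapply Rle_trans; [apply Rabs_triang|]; rewrite Rabs_Ropp.
    assert (e1 * Rabs (S u - S t) <= k * eps / 2 * Rabs h).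
    { apply Rle_trans with (e1 * ((Rabs p' + 1) * Rabs h / c)).
      - apply Rmult_le_compat_l; lra.
      - apply Req_le; unfold e1; field; lra. }
    pose proof (Rmult_le_compat_r (Rabs h) e2 (k * eps / 2) hh (Rmin_r _ _)); lra. }
  apply (Rmult_le_reg_l k); [exact hk|].
  rewrite <- (Rabs_pos_eq k) at 1 by lra; rewrite <- Rabs_mult.
  replace (k * (S u - S t - p' / k * h)) with (k * (S u - S t) - p' * h) by (field; lra).
  lra.
Qed.

Section PotentialCurve.

Variables A B : R.

(* On [z_2 = 1] the equation of the potential [Phi = exp s] reads [|z_1|^2 = curve s]. *)
Definition curve (s : R) : R := exp (A * s) - exp ((A - B) * s).
Definition curve1 (s : R) : R := A * exp (A * s) - (A - B) * exp ((A - B) * s).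
Definition curve2 (s : R) : R := A² * exp (A * s) - (A - B)² * exp ((A - B) * s).

(* A quarter of [Delta_{z_1} Phi / Phi] on [z_2 = 1], in terms of [s = ln Phi]. *)
Definition quarter_laplacian (s : R) : R :=
  / curve1 s + curve s * (curve1 s - curve2 s) / (curve1 s) ^ 3.

Hypothesis hB : 0 < B.
Hypothesis hA : B <= A.

Lemma curve_0 : curve 0 = 0.
Proof. unfold curve; rewrite !Rmult_0_r; ring. Qed.

Lemma curve_derive s : is_derive curve s (curve1 s).
Proof. unfold curve, curve1; auto_derive; [trivial | ring]. Qed.

Lemma curve1_derive s : is_derive curve1 s (curve2 s).
Proof. unfold curve1, curve2, Rsqr; auto_derive; [trivial | ring]. Qed.

(** Replacing [exp (A * s)] by the smaller [exp ((A - B) * s)] leaves [B * exp ((A - B) * s)], at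
    least [B]. *)
Lemma curve1_ge s : 0 <= s -> B <= curve1 s.
Proof.
  intros hs; unfold curve1.
  assert (E1 : exp ((A - B) * s) <= exp (A * s)).
  { assert (K : (A - B) * s <= A * s) by nra.
    destruct K as [K| ->]; [apply Rlt_le, exp_increasing, K | apply Rle_refl]. }
  assert (E2 : 1 <= exp ((A - B) * s)).
  { assert (K : 0 <= (A - B) * s) by (apply Rmult_le_pos; lra).
    pose proof (exp_ineq1_le ((A - B) * s)); lra. }
  nra.
Qed.

(** The mean value theorem with [curve1_ge]; this is the expansion hypothesis of
    [is_derive_implicit], and it also yields injectivity. *)
Lemma curve_expanding s t : 0 <= s -> 0 <= t -> B * Rabs (s - t) <= Rabs (curve s - curve t).
Proof.
  assert (H : forall s t, 0 <= s <= t -> B * (t - s) <= curve t - curve s).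
  { intros a b hab.
    destruct (MVT_gen curve a b curve1) as (c & hc & E).
    - intros x _; apply curve_derive.
    - intros x _; apply derivable_continuous_pt, ex_derive_Reals_0; eexists; apply curve_derive.
    - rewrite Rmin_left, Rmax_right in hc by lra; rewrite E.
      apply Rmult_le_compat_r; [lra | apply curve1_ge; lra]. }
  intros hs ht; destruct (Rle_or_lt s t) as [K|K].
  - specialize (H s t ltac:(lra)).
    rewrite (Rabs_minus_sym s), (Rabs_minus_sym (curve s)), !Rabs_pos_eq by nra; exact H.
  - specialize (H t s ltac:(lra)); rewrite !Rabs_pos_eq by nra; exact H.
Qed.

Lemma curve_inj s t : 0 <= s -> 0 <= t -> curve s = curve t -> s = t.
Proof.
  intros hs ht E; pose proof (curve_expanding s t hs ht) as H.
  rewrite E, Rminus_diag, Rabs_R0 in H; pose proof (Rabs_pos (s - t)).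
  destruct (Req_dec s t) as [K|K]; [exact K|].
  assert (0 < Rabs (s - t)) by (apply Rabs_pos_lt; lra); nra.
Qed.

Lemma curve_ge0_inv s : 0 <= curve s -> 0 <= s.
Proof.
  intros H; destruct (Rle_or_lt 0 s) as [K|K]; [exact K|exfalso].
  assert (exp (A * s) < exp ((A - B) * s)) by (apply exp_increasing; nra).
  unfold curve in H; lra.
Qed.

(* This is where the sign of the [|z_1|^4] coefficient of [Phi] enters. *)
Lemma quarter_laplacian_decay : 1 < A -> A + B = 2 ->
  quarter_laplacian 0 = / B /\
  exists eps s1, 0 < eps /\ 0 < s1 /\ forall s, 0 < s < s1 ->
    quarter_laplacian s * (1 + (/ B + eps) * curve s) < / B.
Proof.
  intros h1 hAB.
  assert (E1 : curve1 0 = B) by (unfold curve1; rewrite !Rmult_0_r, exp_0; ring).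
  assert (E2 : curve2 0 = B * (2 * A - B))
    by (unfold curve2, Rsqr; rewrite !Rmult_0_r, exp_0; ring).
  assert (E0 : quarter_laplacian 0 = / B)
    by (unfold quarter_laplacian; rewrite curve_0, E1; field; lra).
  split; [exact E0|].
  (* In [rho = |z_1|^2] the coefficient of [rho^2] in [Phi] is [k = -3 (A - 1) / (2 B^2)], and [psi]
     has slope [4 k + eps / B] at 0. This [eps] makes it [-5 (A - 1) / B^2], that is
     [-5 (A - 1) / B] with respect to [s]. *)
  set (eps := (A - 1) / B).
  assert (heps : 0 < eps) by (apply Rdiv_lt_0_compat; lra).
  set (psi := fun s => quarter_laplacian s * (1 + (/ B + eps) * curve s)).
  assert (D2 : ex_derive curve2 0) by (unfold curve2; auto_derive; trivial).
  assert (D : is_derive psi 0 (- 5 * (A - 1) / B)).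
  { unfold psi, quarter_laplacian; auto_derive.
    - assert (E3 : curve1 0 * (curve1 0 * (curve1 0 * 1)) <> 0)
        by (rewrite E1; apply Rgt_not_eq; repeat apply Rmult_lt_0_compat; lra).
      repeat split; try (rewrite E1; lra); try exact E3; try exact D2;
        try (exists (curve1 0); apply curve_derive); exists (curve2 0); apply curve1_derive.
    - rewrite (is_derive_unique (fun s : R => curve s) _ _ (curve_derive 0)).
      rewrite (is_derive_unique (fun s : R => curve1 s) _ _ (curve1_derive 0)).
      rewrite curve_0, E1, E2; unfold eps; replace A with (2 - B) by lra; field; lra. }
  (* The error slope [(A - 1) / B] is a fifth of the slope of [psi], so the decrease survives. *)
  destruct (is_derive_bound psi 0 _ D ((A - 1) / B) heps) as (d & hd & Hd).
  exists eps, d; split; [exact heps|]; split; [exact hd|]; intros s hs.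
  specialize (Hd s); rewrite Rminus_0_r, Rabs_pos_eq in Hd by lra; specialize (Hd ltac:(lra)).
  assert (P0 : psi 0 = / B) by (unfold psi; rewrite E0, curve_0; ring).
  rewrite P0 in Hd; apply Rabs_le_between in Hd.
  change (psi s < / B).
  assert (0 < (A - 1) / B * s) by (apply Rmult_lt_0_compat; [exact heps | lra]).
  replace (-5 * (A - 1) / B * s) with (- 5 * ((A - 1) / B * s)) in Hd by (unfold Rdiv; ring).
  lra.
Qed.

Section Slice.

Variable S : R -> R -> R.
Hypothesis HS : forall x y, curve (S x y) = x² + y².

Lemma slice_ge0 x y : 0 <= S x y.
Proof.
  apply curve_ge0_inv; rewrite HS.
  pose proof (Rle_0_sqr x); pose proof (Rle_0_sqr y); lra.
Qed.

Lemma slice_derive (x y : R -> R) t x' y' : is_derive x t x' -> is_derive y t y' ->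
  is_derive (fun t => S (x t) (y t)) t
    ((2 * x t * x' + 2 * y t * y') / curve1 (S (x t) (y t))).
Proof.
  intros hx hy.
  apply (is_derive_implicit curve (fun t => (x t)² + (y t)²)) with (c := B).
  - apply curve_derive.
  - unfold Rsqr; auto_derive.
    + repeat split; eexists; eassumption.
    + rewrite (is_derive_unique (fun t : R => x t) t x' hx), (is_derive_unique (fun t : R => y t) t y' hy).
      ring.
  - pose proof (curve1_ge _ (slice_ge0 (x t) (y t))); lra.
  - exact hB.
  - intros u; apply HS.
  - intros u; apply curve_expanding; apply slice_ge0.
Qed.

Lemma exp_slice_derive (x y : R -> R) t x' y' : is_derive x t x' -> is_derive y t y' ->
  is_derive (fun t => exp (S (x t) (y t))) t
    (exp (S (x t) (y t)) / curve1 (S (x t) (y t)) * (2 * x t * x' + 2 * y t * y')).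
Proof.
  intros hx hy; pose proof (slice_derive x y t x' y' hx hy) as H.
  pose proof (curve1_ge _ (slice_ge0 (x t) (y t))) as hk.
  set (T := fun t => S (x t) (y t)) in *.
  change (S (x t) (y t)) with (T t) in *.
  change (is_derive (fun t => exp (T t)) t
    (exp (T t) / curve1 (T t) * (2 * x t * x' + 2 * y t * y'))).
  auto_derive.
  - eexists; exact H.
  - rewrite (is_derive_unique (fun t : R => T t) t _ H); field; lra.
Qed.

(** For the second derivatives of [exp S]: each component of its gradient is [exp S / curve1 S]
    times [2 x] or [2 y], and along a coordinate line that last factor is affine, [c + c' * t]. *)
Lemma slice_gradient_derive (x y : R -> R) t x' y' (c c' : R) :
  is_derive x t x' -> is_derive y t y' ->
  is_derive (fun t => exp (S (x t) (y t)) / curve1 (S (x t) (y t)) * (c + c' * t)) t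
    (exp (S (x t) (y t)) / curve1 (S (x t) (y t)) * c' +
     exp (S (x t) (y t)) * (curve1 (S (x t) (y t)) - curve2 (S (x t) (y t)))
       / curve1 (S (x t) (y t)) ^ 3 * (2 * x t * x' + 2 * y t * y') * (c + c' * t)).
Proof.
  intros hx hy; pose proof (slice_derive x y t x' y' hx hy) as H.
  pose proof (curve1_ge _ (slice_ge0 (x t) (y t))) as hk.
  set (T := fun t => S (x t) (y t)) in *.
  change (S (x t) (y t)) with (T t) in *.
  change (is_derive (fun t => exp (T t) / curve1 (T t) * (c + c' * t)) t
    (exp (T t) / curve1 (T t) * c' + exp (T t) * (curve1 (T t) - curve2 (T t))
       / curve1 (T t) ^ 3 * (2 * x t * x' + 2 * y t * y') * (c + c' * t))).
  auto_derive.
  - repeat split; try (eexists; exact H); try (eexists; apply curve1_derive); lra.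
  - rewrite (is_derive_unique (fun t : R => T t) t _ H).
    rewrite (is_derive_unique (fun s : R => curve1 s) _ _ (curve1_derive _)).
    field; lra.
Qed.

End Slice.

End PotentialCurve.

(** * Nonexistence when the moduli differ *)


Section NormForm.

Context {N : dim}.
Implicit Types x v w : Cn_NormedModule N.

Lemma sqnorm_rip x : sqnorm x = rip x x.
Proof. symmetry; apply rip_self. Qed.

Lemma is_derive_sqnorm_line x v :
  is_derive (fun t : R => sqnorm (plus x (scal (RtoC t) v))) 0 (2 * rip x v).
Proof.
  apply (is_derive_ext (fun t => rip x x + t * (2 * rip x v) + t ^ 2 * rip v v)).
  - intros t; rewrite sqnorm_rip.
    change (plus x (scal (RtoC t) v)) with (Cn_plus N x (Cn_scal N (RtoC t) v)).
    rewrite rip_plus_l, !rip_plus_r, rip_scal_scal, rip_scal_l, rip_scal_r, (rip_sym v x).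
    rewrite Cmod_R, <- Rsqr_abs; unfold Rsqr; simpl; ring.
  - auto_derive; [trivial | ring].
Qed.

Lemma dir_deriv_sqnorm x v : dir_deriv sqnorm x v = 2 * rip x v.
Proof. apply is_derive_unique, is_derive_sqnorm_line. Qed.

Lemma dc_sqnorm x v : dc sqnorm x v = - 2 * rip x (Cn_scal N Ci v).
Proof. unfold dc; rewrite dir_deriv_sqnorm; unfold scal; simpl; ring. Qed.

Lemma ddc_sqnorm x v w : ddc sqnorm x v w = - 4 * rip v (Cn_scal N Ci w).
Proof.
  assert (K : forall a b, dir_deriv (fun y => dc sqnorm y b) x a
    = - 2 * rip a (Cn_scal N Ci b)).
  { intros a b; unfold dir_deriv; apply is_derive_unique.
    apply (is_derive_ext (fun t => - 2 * (rip x (Cn_scal N Ci b) + t * rip a (Cn_scal N Ci b)))).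
    - intros t; rewrite dc_sqnorm.
      change (plus x (scal (RtoC t) a)) with (Cn_plus N x (Cn_scal N (RtoC t) a)).
      rewrite rip_plus_l, (rip_scal_l (RtoC t)); simpl; ring.
    - auto_derive; [trivial | ring]. }
  unfold ddc, ext_deriv; rewrite !K, (rip_sym w), rip_Ci_l; ring.
Qed.

(** On a pair [v], [i v] the form is a squared length, so a pullback identity becomes an identity of
    norms. Both nonexistence arguments use only such pairs. *)
Lemma lck_form_sqnorm_Ci x v : lck_form sqnorm x v (scal Ci v) = 4 * rip v v / rip x x.
Proof.
  unfold lck_form; rewrite ddc_sqnorm, sqnorm_rip.
  change (scal Ci v) with (Cn_scal N Ci v).
  replace (rip v (Cn_scal N Ci (Cn_scal N Ci v))) with (- rip v v)
    by (rewrite <- (rip_Ci_Ci v v), rip_Ci_l; ring).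
  unfold Rdiv; ring.
Qed.

Lemma Cn_scal_nonzero (c : C) x : c <> RtoC 0 -> x <> zero -> Cn_scal N c x <> zero.
Proof.
  intros hc hx E; apply hx, Cn_norm_eq0.
  assert (H : Cmod c * Cn_norm N x = 0).
  { rewrite <- Cn_norm_scal, E; apply Cn_norm_zero. }
  apply Rmult_integral in H; destruct H as [H|H]; [|exact H].
  exfalso; apply hc, Cmod_eq_0, H.
Qed.

Lemma orbit_scal_nonzero (c : C) x v : c <> RtoC 0 -> x <> zero ->
  orbit (fun z : Cn_NormedModule N => scal c z) x v -> v <> zero.
Proof.
  intros hc hx [n [E|E]] E0; apply hx; clear hx.
  - rewrite E in E0; clear E; induction n as [|n IH]; [exact E0|].
    apply IH; simpl in E0; apply NNPP; intros K; exact (Cn_scal_nonzero c _ hc K E0).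
  - rewrite E, E0; clear; induction n as [|n IH]; [reflexivity|].
    transitivity (scal c (zero : Cn_NormedModule N));
      [exact (f_equal (fun z : Cn_NormedModule N => scal c z) IH) |].
    apply Cn_ext; intros j; apply Cmult_0_r.
Qed.

End NormForm.

(** Passage to the coverings. The lift [f] has no zeros because fibres in the target are orbits of
    nonzero vectors, and complex linearity of [L] carries [v], [i v] to [L v], [i L v]. *)
Lemma lck_immersion_lift (a b : C) (Phi : C2 -> R) (N : dim) (lambda : C) (x : H_lin a b)
  (z0 : C2) : lambda <> RtoC 0 -> fibre x z0 -> lck_immersion_near a b Phi N lambda x ->
  exists (D : C2 -> Prop) (f : C2 -> Cn_NormedModule N), open D /\ D z0 /\
    forall z, D z -> z <> zero /\ 0 < rip (f z) (f z) /\
      exists L, filterdiff f (locally z) L /\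
        forall v, 4 * rip (L v) (L v) / rip (f z) (f z) = lck_form Phi z v (scal Ci v).
Proof.
  intros hl hx (U & F & _ & hU & HF).
  destruct (HF z0) as (D & f & hD & (openD & _ & Hlift) & Hpull).
  { exists x; split; assumption. }
  exists D, f; split; [exact openD|]; split; [exact hD|]; intros z hz.
  destruct (Hlift z hz) as [z_nz Hfib]; split; [exact z_nz|].
  assert (f_nz : f z <> zero).
  (* The lift condition speaks of points of the quotient, so the class of [z] is formed in order to
     apply it. *)
  { set (p := mkHopf C2 (linear_gen a b) (orbit (linear_gen a b) z)
      (ex_intro _ z (conj z_nz eq_refl))).
    assert (hp : fibre p z) by (exists 0%nat; left; reflexivity).
    specialize (Hfib p hp); destruct (fibre_orbit _ _ (F p)) as (w & hw & E).
    rewrite E in Hfib; exact (orbit_scal_nonzero lambda w (f z) hl hw Hfib). }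
  split.
  { destruct (rip_ge0 (f z)) as [H|H]; [exact H|exfalso; apply f_nz, rip_eq0; symmetry; exact H]. }
  destruct (Hpull z hz) as (L & HL & E); exists L; split; [exact HL|]; intros v.
  rewrite <- E, <- lck_form_sqnorm_Ci; f_equal.
  symmetry; apply (linear_scal L (proj1 HL)).
Qed.

Definition e1 : C2 := (RtoC 1, RtoC 0).

Lemma dir_deriv_e1 (F : C2 -> R) (x y : R) : dir_deriv F ((x, y) : C, RtoC 1) e1
  = Derive (fun t => F ((x + t, y) : C, RtoC 1)) 0.
Proof.
  apply Derive_ext; intros t; f_equal; unfold e1.
  unfold plus, scal; simpl; unfold prod_plus, prod_scal, scal, plus; simpl.
  unfold mult; simpl; unfold Cmult, Cplus, RtoC; simpl; repeat apply injective_projections; simpl; ring.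
Qed.

Lemma dir_deriv_Ci_e1 (F : C2 -> R) (x y : R) :
  dir_deriv F ((x, y) : C, RtoC 1) (scal Ci e1)
  = Derive (fun t => F ((x, y + t) : C, RtoC 1)) 0.
Proof.
  apply Derive_ext; intros t; f_equal; unfold e1.
  unfold plus, scal; simpl; unfold prod_plus, prod_scal, scal, plus; simpl.
  unfold mult; simpl; unfold Cmult, Cplus, RtoC; simpl; repeat apply injective_projections; simpl; ring.
Qed.

Lemma dir_deriv_Ci_Ci_e1 (F : C2 -> R) (x y : R) :
  dir_deriv F ((x, y) : C, RtoC 1) (scal Ci (scal Ci e1))
  = Derive (fun t => F ((x - t, y) : C, RtoC 1)) 0.
Proof.
  apply Derive_ext; intros t; f_equal; unfold e1.
  unfold plus, scal; simpl; unfold prod_plus, prod_scal, scal, plus; simpl.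
  unfold mult; simpl; unfold Cmult, Cplus, RtoC; simpl; repeat apply injective_projections; simpl; ring.
Qed.

(** * The Gauduchon-Ornea potential on [z_2 = 1] and the obstruction at [z_1 = 0] *)

Section Potential.

Variables (alpha beta : C) (Phi : C2 -> R).
Hypothesis h_beta : 1 < Cmod beta.
Hypothesis h_alpha : Cmod beta <= Cmod alpha.
Hypothesis h_Phi : Gauduchon_Ornea_potential alpha beta Phi.

Let A := 2 * ln (Cmod alpha) / (ln (Cmod alpha) + ln (Cmod beta)).
Let B := 2 * ln (Cmod beta) / (ln (Cmod alpha) + ln (Cmod beta)).

Let S (x y : R) : R := ln (Phi ((x, y) : C, RtoC 1)).

Lemma ln_beta_pos : 0 < ln (Cmod beta).
Proof. rewrite <- ln_1; apply ln_increasing; lra. Qed.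

Lemma ln_beta_le : ln (Cmod beta) <= ln (Cmod alpha).
Proof. apply ln_le; lra. Qed.

Lemma weight_pos : 0 < B.
Proof. pose proof ln_beta_pos; pose proof ln_beta_le; apply Rdiv_lt_0_compat; lra. Qed.

Lemma weight_le : B <= A.
Proof.
  pose proof ln_beta_pos; pose proof ln_beta_le; unfold A, B.
  apply Rmult_le_compat_r; [apply Rlt_le, Rinv_0_lt_compat; lra | lra].
Qed.

Lemma weight_sum : A + B = 2.
Proof. pose proof ln_beta_pos; pose proof ln_beta_le; unfold A, B; field; lra. Qed.

Lemma slice_nonzero (c : C) : ((c, RtoC 1) : C2) <> zero.
Proof.
  intros E; apply (f_equal snd) in E; simpl in E; unfold zero in E; simpl in E.
  apply (f_equal fst) in E; simpl in E; lra.
Qed.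

Lemma potential_slice x y : Phi ((x, y) : C, RtoC 1) = exp (S x y).
Proof.
  destruct (h_Phi ((x, y) : C, RtoC 1) (slice_nonzero _)) as [H _].
  unfold S; rewrite exp_ln; [reflexivity | exact H].
Qed.

(** The defining equation of [Phi] at [z_2 = 1], multiplied by [exp (A * s)]. *)
Lemma potential_slice_curve x y : curve A B (S x y) = x² + y².
Proof.
  destruct (h_Phi ((x, y) : C, RtoC 1) (slice_nonzero _)) as [_ H].
  fold A B in H; unfold Rpower in H; fold (S x y) in H; simpl fst in H; simpl snd in H.
  rewrite Cmod_1, !Cmod_sqr in H; unfold re_dot in H; simpl in H.
  unfold curve; set (s := S x y) in *.
  assert (E : exp (A * s) * exp (- A * s) = 1)
    by (rewrite <- exp_plus, <- exp_0; f_equal; ring).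
  replace ((A - B) * s) with (A * s + - B * s) by ring; rewrite exp_plus.
  apply (f_equal (Rmult (exp (A * s)))) in H; rewrite Rmult_1_r in H.
  assert (H2 : (x * x + y * y) * (exp (A * s) * exp (- A * s)) + exp (A * s) * exp (- B * s)
    = exp (A * s)) by (rewrite <- H at 3; unfold Rsqr; ring).
  rewrite E in H2; unfold Rsqr; lra.
Qed.

Let slice_ge0 x y : 0 <= S x y := slice_ge0 A B weight_pos S potential_slice_curve x y.

(** On [i e1] the form [d^c Phi] is the [x]-derivative, since [i i e1 = - e1], and on [e1] it is
    minus the [y]-derivative. Hence [dd^c Phi] on [e1], [i e1] is the Laplacian in [z_1]. *)
Lemma lck_form_slice x y :
  lck_form Phi ((x, y) : C, RtoC 1) e1 (scal Ci e1) = 4 * quarter_laplacian A B (S x y).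
Proof.
  set (m := fun s => exp s / curve1 A B s).
  assert (D : forall (u v : R -> R) t u' v', is_derive u t u' -> is_derive v t v' ->
    Derive (fun t => Phi ((u t, v t) : C, RtoC 1)) t
    = m (S (u t) (v t)) * (2 * u t * u' + 2 * v t * v')).
  { intros u v t u' v' hu hv; apply is_derive_unique.
    apply (is_derive_ext (fun t => exp (S (u t) (v t))));
      [intros; symmetry; apply potential_slice|].
    apply (exp_slice_derive A B weight_pos weight_le S potential_slice_curve u v t u' v' hu hv). }
  assert (Dx : forall x y, dc Phi ((x, y) : C, RtoC 1) (scal Ci e1) = m (S x y) * (2 * x)).
  { intros a b; unfold dc; rewrite dir_deriv_Ci_Ci_e1.
    rewrite (D (fun t => a - t) (fun _ => b) 0 (- 1) 0);
      [rewrite Rminus_0_r; cbv beta; ring | auto_derive; [trivial | ring] | auto_derive; [trivial | ring]]. }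
  assert (Dy : forall x y, dc Phi ((x, y) : C, RtoC 1) e1 = - (m (S x y) * (2 * y))).
  { intros a b; unfold dc; rewrite dir_deriv_Ci_e1.
    rewrite (D (fun _ => a) (fun t => b + t) 0 0 1);
      [rewrite Rplus_0_r; cbv beta; ring | auto_derive; [trivial | ring] | auto_derive; [trivial | ring]]. }
  unfold lck_form, ddc, ext_deriv; rewrite dir_deriv_e1, dir_deriv_Ci_e1.
  rewrite (Derive_ext _ (fun t => m (S (x + t) y) * (2 * x + 2 * t)))
    by (intros t; rewrite Dx; ring).
  rewrite (Derive_ext (fun t => dc Phi ((x, y + t) : C, RtoC 1) e1)
    (fun t => - (m (S x (y + t)) * (2 * y + 2 * t)))) by (intros t; rewrite Dy; ring).
  rewrite Derive_opp.
  pose proof (slice_gradient_derive A B weight_pos weight_le S potential_slice_curve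
    (fun t => x + t) (fun _ => y) 0 1 0 (2 * x) 2
    ltac:(auto_derive; [trivial | ring]) ltac:(auto_derive; [trivial | ring])) as G1.
  pose proof (slice_gradient_derive A B weight_pos weight_le S potential_slice_curve
    (fun _ => x) (fun t => y + t) 0 0 1 (2 * y) 2
    ltac:(auto_derive; [trivial | ring]) ltac:(auto_derive; [trivial | ring])) as G2.
  cbv beta in G1, G2.
  pose proof (is_derive_unique _ _ _ G1
    : Derive (fun t : R => m (S (x + t) y) * (2 * x + 2 * t)) 0 = _) as E1.
  pose proof (is_derive_unique _ _ _ G2
    : Derive (fun t : R => m (S x (y + t)) * (2 * y + 2 * t)) 0 = _) as E2.
  rewrite E1, E2, potential_slice.
  rewrite !Rplus_0_r; unfold quarter_laplacian; rewrite potential_slice_curve.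
  pose proof (curve1_ge A B weight_pos weight_le _ (slice_ge0 x y)).
  pose proof weight_pos; pose proof (exp_pos (S x y)); unfold Rsqr; field; lra.
Qed.

(** Both values solve the same equation for [curve], which is injective on nonnegative reals. This
    makes the weight [W] below a function of the radius alone. *)
Lemma potential_slice_radial (c : C) : S (fst c) (snd c) = S (Cmod c) 0.
Proof.
  apply (curve_inj A B weight_pos weight_le); try apply slice_ge0.
  rewrite !potential_slice_curve, Cmod_sqr; unfold re_dot, Rsqr; ring.
Qed.

Lemma norm_prod_0 (k : C) : norm ((k, RtoC 0) : C2) = Cmod k.
Proof.
  unfold norm; simpl; unfold prod_norm, norm; simpl.
  rewrite Cmod_0; replace (Cmod k * (Cmod k * 1) + 0 * (0 * 1)) with (Cmod k * Cmod k) by ring.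
  apply sqrt_square, Cmod_ge_0.
Qed.

Lemma locally_slice (P : C2 -> Prop) (c : C) : locally ((c, RtoC 1) : C2) P ->
  exists d, 0 < d /\ forall k, Cmod k < d -> P (Cplus c k, RtoC 1).
Proof.
  intros [d Hd]; exists d; split; [apply cond_pos|]; intros k hk; apply Hd.
  pose proof (Rmax_Cmod k) as Hm.
  split; [split|apply ball_center]; simpl;
    change (ball ?a ?e ?b) with (Rabs (minus b a) < e); unfold minus, plus, opp; simpl.
  - replace (fst c + fst k + - fst c) with (fst k) by ring.
    pose proof (Rmax_l (Rabs (fst k)) (Rabs (snd k))); lra.
  - replace (snd c + snd k + - snd c) with (snd k) by ring.
    pose proof (Rmax_r (Rabs (fst k)) (Rabs (snd k))); lra.
Qed.

Lemma filterdiff_slice {N : dim} (f L : C2 -> Cn_NormedModule N) (c : C) :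
  filterdiff f (locally ((c, RtoC 1) : C2)) L -> hol_at (fun c => f (c, RtoC 1)) c (L e1).
Proof.
  intros [HL H] eps he.
  specialize (H (c, RtoC 1) (fun P HP => HP) (mkposreal eps he)).
  destruct (locally_slice _ c H) as (d & hd & Hd); exists d; split; [exact hd|].
  intros k hk; specialize (Hd k hk); cbv beta in Hd.
  assert (E : minus ((Cplus c k, RtoC 1) : C2) (c, RtoC 1) = (k, RtoC 0)).
  { unfold minus, plus, opp; simpl; unfold prod_plus, prod_opp, plus, opp; simpl.
    unfold Cplus, Copp, RtoC; simpl; destruct k; simpl; repeat f_equal; ring. }
  rewrite E, norm_prod_0 in Hd.
  replace ((k, RtoC 0) : C2) with (scal k e1 : C2) in Hd.
  2: { unfold e1, scal; simpl; unfold prod_scal, scal; simpl; unfold mult; simpl.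
       f_equal; ring. }
  rewrite (linear_scal L HL) in Hd.
  match goal with |- Cn_norm N ?x <= _ => match type of Hd with norm ?y <= _ =>
    replace x with y; [exact Hd|] end end.
  apply Cn_ext; intros j; simpl; ring.
Qed.

(** With [A0 = |g(0)|^2] the contradiction reads [A0 / B <= A0 * W r * (1 + (1 / B + eps) * r²) < A0
    / B]: the first inequality is [derivative_norm_bound], the second [quarter_laplacian_decay]. *)
Theorem no_immersion_near_axis (N : dim) (lambda : C) (x : H_lin alpha beta) :
  Cmod beta < Cmod alpha -> lambda <> RtoC 0 -> fibre x (RtoC 0, RtoC 1) ->
  ~ lck_immersion_near alpha beta Phi N lambda x.
Proof.
  intros hab hl hx Himm.
  assert (hA : 1 < A).
  { assert (ln (Cmod beta) < ln (Cmod alpha)) by (apply ln_increasing; lra).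
    pose proof ln_beta_pos; unfold A.
    apply (Rmult_lt_reg_r (ln (Cmod alpha) + ln (Cmod beta))); [lra|].
    unfold Rdiv; rewrite Rmult_assoc, Rinv_l; lra. }
  pose proof weight_pos as hB.
  destruct (lck_immersion_lift alpha beta Phi N lambda x _ hl hx Himm)
    as (D & f & openD & hD & Hf).
  destruct (locally_slice D (RtoC 0) (openD _ hD)) as (R0 & hR0 & HR0).
  set (g := fun c : C => f (c, RtoC 1)).
  set (W := fun r => quarter_laplacian A B (S r 0)).
  (* The derivative is chosen at every point of the disc, together with its norm identity; outside
     the disc the value is arbitrary. *)
  assert (Hex : forall c, exists l, Cmod c < R0 -> 0 < rip (g c) (g c) /\ hol_at g c l /\
    rip l l = W (Cmod c) * rip (g c) (g c)).
  { intros c; destruct (classic (Cmod c < R0)) as [hc|hc]; [|exists (Cn_zero N); contradiction].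
    specialize (HR0 c hc); rewrite Cplus_0_l in HR0.
    destruct (Hf _ HR0) as (_ & hpos & L & HL & E).
    exists (L e1); intros _; split; [exact hpos|]; split; [apply filterdiff_slice, HL|].
    specialize (E e1).
    replace ((c, RtoC 1) : C2) with (((fst c, snd c) : C, RtoC 1) : C2) in E at 3
      by (destruct c; reflexivity).
    rewrite lck_form_slice, potential_slice_radial in E; unfold W.
    change (f (c, RtoC 1)) with (g c) in *.
    apply (f_equal (fun t => t * rip (g c) (g c) / 4)) in E.
    replace (4 * rip (L e1) (L e1) / rip (g c) (g c) * rip (g c) (g c) / 4)
      with (rip (L e1) (L e1)) in E by (field; lra).
    rewrite E; field. }
  destruct (choice _ Hex) as [g' Hg'].
  set (A0 := rip (g (RtoC 0)) (g (RtoC 0))).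
  assert (h0 : Cmod (RtoC 0) < R0) by (rewrite Cmod_0; exact hR0).
  assert (hA0 : 0 < A0) by (apply (Hg' (RtoC 0) h0)).
  destruct (quarter_laplacian_decay A B hB hA weight_sum) as (EW & eps & s1 & heps & hs1 & Hdec).
  assert (ES0 : S 0 0 = 0).
  { apply (curve_inj A B weight_pos weight_le); [apply slice_ge0 | lra |].
    rewrite potential_slice_curve, curve_0; unfold Rsqr; ring. }
  (* At the centre [S = 0] and [W = 1 / B], which fixes the ratio of [|g'(0)|^2] to [|g(0)|^2]. The
     estimate is homogeneous in [A0], hence [eps * A0] in the next step. *)
  assert (EA1 : rip (g' (RtoC 0)) (g' (RtoC 0)) = / B * A0).
  { destruct (Hg' _ h0) as (_ & _ & ->); unfold W; rewrite Cmod_0, ES0, EW; reflexivity. }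
  destruct (derivative_norm_bound g g' W R0 hR0) with (eps := eps * A0) as (d & hd & Hd).
  { intros z hz; apply Hg', hz. }
  { intros z hz; apply Hg', hz. }
  { intros r hr.
    destruct (Hg' (RtoC r)) as (hp & _ & E).
    { rewrite Cmod_R, Rabs_pos_eq; lra. }
    rewrite Cmod_R, Rabs_pos_eq in E by lra.
    pose proof (rip_ge0 (g' (RtoC r))) as K; rewrite E in K.
    destruct (Rle_or_lt 0 (W r)) as [J|J]; [exact J | nra]. }
  { apply Rmult_lt_0_compat; assumption. }
  (* The second bound gives [r² <= B * s1 / 2], and [curve_expanding] turns it into
     [S r 0 <= s1 / 2], inside the range of [Hdec]. *)
  set (r := Rmin (d / 2) (sqrt (B * s1 / 2))).
  assert (hBs : 0 < B * s1 / 2) by (assert (0 < B * s1) by (apply Rmult_lt_0_compat; lra); lra).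
  assert (hr : 0 < r) by (apply Rmin_pos; [lra | apply sqrt_lt_R0; exact hBs]).
  assert (hrd : r < d) by (pose proof (Rmin_l (d / 2) (sqrt (B * s1 / 2))); unfold r; lra).
  assert (hrs : r² <= B * s1 / 2).
  { rewrite <- (Rsqr_sqrt (B * s1 / 2)) by lra.
    apply Rsqr_incr_1; [apply Rmin_r | lra | apply sqrt_pos]. }
  assert (Er : curve A B (S r 0) = r²) by (rewrite potential_slice_curve; unfold Rsqr; ring).
  assert (hr2 : 0 < r²) by (apply Rsqr_pos_lt; lra).
  assert (hs : 0 < S r 0 < s1).
  { split.
    - destruct (slice_ge0 r 0) as [H|H]; [exact H|exfalso].
      rewrite <- H, curve_0 in Er; lra.
    - pose proof (curve_expanding A B weight_pos weight_le (S r 0) 0 (slice_ge0 r 0) (Rle_refl 0)) as K.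
      rewrite curve_0, Er, !Rminus_0_r, !Rabs_pos_eq in K by (apply slice_ge0 || lra).
      apply (Rmult_lt_reg_l B); lra. }
  specialize (Hd r (conj hr hrd)); specialize (Hdec _ hs).
  rewrite EA1 in Hd; fold A0 in Hd; rewrite Er in Hdec; fold (W r) in Hdec.
  replace (W r * (A0 + (/ B * A0 + eps * A0) * r²))
    with (A0 * (W r * (1 + (/ B + eps) * r²))) in Hd by ring.
  apply (Rmult_lt_compat_l A0) in Hdec; lra.
Qed.

End Potential.

(** * Existence and fullness when the moduli agree *)


Section FormOperations.

Context {V W : NormedModule C_AbsRing}.

Lemma dir_deriv_linear (F : W -> R) (l : V -> W) (x v : V) : is_linear l ->
  dir_deriv (fun y => F (l y)) x v = dir_deriv F (l x) (l v).
Proof.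
  intros Hl; apply Derive_ext; intros t.
  rewrite (linear_plus l Hl), (linear_scal l Hl); reflexivity.
Qed.

Lemma dc_linear (F : W -> R) (l : V -> W) (x v : V) : is_linear l ->
  dc (fun y => F (l y)) x v = dc F (l x) (l v).
Proof. intros Hl; unfold dc; rewrite dir_deriv_linear, (linear_scal l Hl) by exact Hl; reflexivity. Qed.

Lemma ddc_linear (F : W -> R) (l : V -> W) (x v w : V) : is_linear l ->
  ddc (fun y => F (l y)) x v w = ddc F (l x) (l v) (l w).
Proof.
  intros Hl; unfold ddc, ext_deriv.
  rewrite <- !(dir_deriv_linear _ l) by exact Hl.
  f_equal; apply Derive_ext; intros t; apply dc_linear, Hl.
Qed.

Lemma ddc_Rmult (F : V -> R) (k : R) (x v w : V) :
  ddc (fun y => k * F y) x v w = k * ddc F x v w.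
Proof.
  assert (K : forall G : V -> R, forall y u,
    dir_deriv (fun y => k * G y) y u = k * dir_deriv G y u)
    by (intros G y u; apply Derive_scal).
  assert (Kc : forall u y, dc (fun y => k * F y) y u = k * dc F y u)
    by (intros u y; unfold dc; rewrite K; ring).
  assert (Kd : forall a b, dir_deriv (fun y => dc (fun y => k * F y) y a) x b
    = k * dir_deriv (fun y => dc F y a) x b).
  { intros a b; rewrite <- K; apply Derive_ext; intros t; apply Kc. }
  unfold ddc, ext_deriv; rewrite !Kd; ring.
Qed.

End FormOperations.

Definition sq (z : C2) : R := (Cmod (fst z))² + (Cmod (snd z))².

Lemma norm_C2 (z : C2) : norm z = sqrt (sq z).
Proof.
  unfold norm; simpl; unfold prod_norm, norm, sq, Rsqr; simpl; rewrite !Rmult_1_r; reflexivity.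
Qed.

Lemma sq_ge0 z : 0 <= sq z.
Proof. apply Rplus_le_le_0_compat; apply Rle_0_sqr. Qed.

Lemma sq_zero : sq zero = 0.
Proof.
  change (sq (RtoC 0, RtoC 0) = 0); unfold sq; simpl; rewrite Cmod_0; unfold Rsqr; ring.
Qed.

Lemma continuous_Rmult_sq (k : R) (z : C2) : continuous (fun y : C2 => k * sq y) z.
Proof.
  apply (continuous_ext (fun y : C2 => mult k (mult (norm y) (norm y)))).
  - intros y; rewrite norm_C2; unfold mult; simpl; rewrite sqrt_sqrt by apply sq_ge0; reflexivity.
  - apply (continuous_mult (K := R_AbsRing)); [apply continuous_const|].
    apply (continuous_mult (K := R_AbsRing)); apply filterlim_norm.
Qed.

Lemma is_series_two (a : nat -> R) : (forall k, (2 <= k)%nat -> a k = 0) ->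
  is_series a (a 0%nat + a 1%nat).
Proof.
  intros H; apply (filterlim_ext_loc (fun _ => a 0%nat + a 1%nat)); [|apply filterlim_const].
  exists 1%nat; intros n hn; induction n as [|n IH]; [lia|].
  destruct n as [|n].
  - rewrite sum_Sn, sum_O; reflexivity.
  - rewrite sum_Sn, <- IH, (H (S (S n))) by lia; unfold plus; simpl; ring.
Qed.

Section Embedding.

Variable N : dim.
Hypothesis hN : forall k, beyond N k -> (2 <= k)%nat.

(** Under [hN] the ambient space has at least two coordinates, so one inclusion serves both C^2 and
    l^2(C). *)
Definition iota_coord (z : C2) (k : nat) : C :=
  match k with 0%nat => fst z | 1%nat => snd z | _ => RtoC 0 end.

Lemma iota_series z : is_series (sqmod (iota_coord z)) (sq z).
Proof.
  apply (is_series_two (sqmod (iota_coord z))).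
  intros [|[|k]] hk; [lia | lia |].
  unfold sqmod; simpl; rewrite Cmod_0; unfold Rsqr; ring.
Qed.

Definition iota (z : C2) : Cn_NormedModule N.
Proof.
  refine (mkCn (iota_coord z) _ (ex_intro _ (sq z) (iota_series z))).
  intros k hk; apply hN in hk; destruct k as [|[|k]]; [lia | lia | reflexivity].
Defined.

Lemma sqnorm_iota z : sqnorm (iota z) = sq z.
Proof.
  unfold sqnorm; change (norm (iota z)) with (Cn_norm N (iota z)).
  rewrite Cn_norm_sqr; apply is_series_unique, iota_series.
Qed.

(** The inclusion after a diagonal map. Later [a] and [b] are the entries of a power of the
    generator, and [|a| = |b|] makes the map a homothety onto its image. *)
Definition diag_iota (a b : C) (z : C2) : Cn_NormedModule N :=
  iota (Cmult a (fst z), Cmult b (snd z)).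

Variables a b : C.
Hypothesis hab : Cmod a = Cmod b.
Hypothesis ha : 0 < Cmod a.

Lemma sqnorm_diag_iota z : sqnorm (diag_iota a b z) = (Cmod a)² * sq z.
Proof.
  unfold diag_iota; rewrite sqnorm_iota; unfold sq; simpl.
  rewrite !Cmod_mult, <- hab, !Rsqr_mult; ring.
Qed.

Lemma diag_iota_linear : is_linear (diag_iota a b).
Proof.
  split.
  - intros x y; apply Cn_ext; intros [|[|k]]; simpl; unfold plus; simpl; ring.
  - intros c x; apply Cn_ext; intros [|[|k]]; simpl; unfold scal; simpl; unfold mult; simpl; ring.
  - exists (Cmod a); split; [exact ha|]; intros x; rewrite norm_C2.
    apply Rsqr_incr_0_var.
    + change ((norm (diag_iota a b x))²) with (sqnorm (diag_iota a b x)).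
      rewrite sqnorm_diag_iota, Rsqr_mult, Rsqr_sqrt by apply sq_ge0; apply Rle_refl.
    + apply Rmult_le_pos; [lra | apply sqrt_pos].
Qed.

End Embedding.

Lemma beyond_None k : beyond None k -> (2 <= k)%nat.
Proof. intros []. Qed.

(** The equation determines [Phi] only away from 0, so the lines along which [dd^c] differentiates
    must avoid 0 for small times. *)
Lemma locally_line_nonzero (y v : C2) : y <> zero ->
  locally 0 (fun t : R => plus y (scal (RtoC t) v) <> zero).
Proof.
  intros hy.
  (* The isometric inclusion into l^2(C) lets [is_derive_sqnorm_line] supply the continuity of [sq]
     along the line. *)
  set (l := diag_iota None beyond_None (RtoC 1) (RtoC 1)).
  assert (Hl : is_linear l) by (apply diag_iota_linear; rewrite Cmod_1; lra).
  assert (El : forall z, sq z = sqnorm (l z)).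
  { intros z; unfold l; rewrite sqnorm_diag_iota, Cmod_1 by reflexivity; unfold Rsqr; ring. }
  assert (Hc : continuous (fun t : R => sq (plus y (scal (RtoC t) v))) 0).
  { apply (continuous_ext (fun t : R => sqnorm (plus (l y) (scal (RtoC t) (l v))))).
    - intros t; rewrite El, (linear_plus l Hl), (linear_scal l Hl); reflexivity.
    - apply (ex_derive_continuous (K := R_AbsRing) (V := R_NormedModule)).
      eexists; apply is_derive_sqnorm_line. }
  assert (H0 : 0 < sq (plus y (scal (RtoC 0) v))).
  { replace (plus y (scal (RtoC 0) v)) with y; [apply C2_nonzero, hy|].
    unfold plus, scal; simpl; unfold prod_plus, prod_scal, plus, scal; simpl; unfold mult; simpl.
    rewrite !Cmult_0_l, !Cplus_0_r; apply surjective_pairing. }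
  assert (Hloc : locally 0 (fun t : R => 0 < sq (plus y (scal (RtoC t) v))))
    by exact (Hc _ (open_gt 0 _ H0)).
  revert Hloc; apply filter_imp; intros t ht E.
  rewrite E, sq_zero in ht; lra.
Qed.

Lemma ddc_ext_nonzero (f g : C2 -> R) (z v w : C2) :
  (forall y, y <> zero -> f y = g y) -> z <> zero -> ddc f z v w = ddc g z v w.
Proof.
  intros H.
  assert (K : forall (F G : C2 -> R) y u, (forall y, y <> zero -> F y = G y) -> y <> zero ->
    dir_deriv F y u = dir_deriv G y u).
  { intros F G y u HFG hy; apply Derive_ext_loc.
    generalize (locally_line_nonzero y u hy); apply filter_imp; intros t; apply HFG. }
  intros hz; unfold ddc, ext_deriv.
  f_equal; apply K; try exact hz; intros y hy; unfold dc; f_equal;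
    apply K; assumption.
Qed.

Section EqualModuli.

Variables (alpha beta : C) (Phi : C2 -> R).
Hypothesis h_beta : 1 < Cmod beta.
Hypothesis h_eq : Cmod alpha = Cmod beta.
Hypothesis h_Phi : Gauduchon_Ornea_potential alpha beta Phi.

(** Both exponents become 1, and the equation reads [sq z / Phi z = 1]. *)
Lemma potential_equal_moduli z : z <> zero -> Phi z = sq z.
Proof.
  intros hz; destruct (h_Phi z hz) as [hp E]; rewrite h_eq in E.
  assert (hl : 0 < ln (Cmod beta)) by (rewrite <- ln_1; apply ln_increasing; lra).
  replace (2 * ln (Cmod beta) / (ln (Cmod beta) + ln (Cmod beta))) with 1 in E by (field; lra).
  rewrite Rpower_Ropp, Rpower_1 in E by exact hp.
  apply (f_equal (fun t => t * Phi z)) in E; rewrite Rmult_1_l in E; rewrite <- E.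
  unfold sq; field; lra.
Qed.

(** The homothety multiplies both the potential and its [dd^c] by [|a|^2], and the factor cancels in
    the quotient. *)
Lemma lck_form_diag_iota (N : dim) (hN : forall k, beyond N k -> (2 <= k)%nat) (a b : C)
  (z v w : C2) : Cmod a = Cmod b -> 0 < Cmod a -> z <> zero ->
  lck_form sqnorm (diag_iota N hN a b z) (diag_iota N hN a b v) (diag_iota N hN a b w)
  = lck_form Phi z v w.
Proof.
  intros hab ha hz; unfold lck_form.
  pose proof (diag_iota_linear N hN a b hab ha) as Hl.
  assert (E : ddc sqnorm (diag_iota N hN a b z) (diag_iota N hN a b v) (diag_iota N hN a b w)
    = (Cmod a)² * ddc Phi z v w).
  { rewrite <- (ddc_linear sqnorm _ z v w Hl), <- ddc_Rmult.
    apply ddc_ext_nonzero; [|exact hz]; intros y hy.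
    rewrite sqnorm_diag_iota, potential_equal_moduli by assumption; reflexivity. }
  rewrite E, sqnorm_diag_iota, (potential_equal_moduli z hz) by exact hab.
  pose proof (C2_nonzero z hz) as hs; change (0 < sq z) in hs.
  assert (0 < (Cmod a)²) by (apply Rsqr_pos_lt; lra).
  field; lra.
Qed.

Let g := linear_gen alpha beta.

Lemma iter_linear_gen n : exists a b, Cmod a = Cmod b /\ Cmod a = Cmod beta ^ n /\
  forall y, Nat.iter n g y = (Cmult a (fst y), Cmult b (snd y)).
Proof.
  induction n as [|n (a & b & E1 & E2 & E3)].
  - exists (RtoC 1), (RtoC 1); rewrite Cmod_1; repeat split.
    intros [x y]; simpl; rewrite !Cmult_1_l; reflexivity.
  - exists (Cmult alpha a), (Cmult beta b); rewrite !Cmod_mult, h_eq, E1; split; [reflexivity|].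
    split; [rewrite <- E1, E2; reflexivity|].
    intros y; simpl; rewrite E3; unfold g, linear_gen; simpl; rewrite !Cmult_assoc; reflexivity.
Qed.

(** Treats positive and negative powers of the generator alike: the power that moves [z] to [w] is
    one diagonal map with entries of equal modulus, and it keeps every [y] in its orbit. *)
Lemma orbit_diag z w : orbit g z w -> exists a b, Cmod a = Cmod b /\ 0 < Cmod a /\
  w = (Cmult a (fst z), Cmult b (snd z)) /\
  forall y, orbit g y (Cmult a (fst y), Cmult b (snd y)).
Proof.
  intros [n H]; destruct (iter_linear_gen n) as (a & b & E1 & E2 & E3).
  assert (ha : 0 < Cmod a) by (rewrite E2; apply pow_lt; lra).
  destruct H as [H|H].
  - exists a, b; split; [exact E1|]; split; [exact ha|]; split; [rewrite H; apply E3|].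
    intros y; exists n; left; symmetry; apply E3.
  - assert (a0 : a <> RtoC 0) by (apply Cmod_gt_0, ha).
    assert (b0 : b <> RtoC 0) by (apply Cmod_gt_0; lra).
    assert (K : forall c x, c <> RtoC 0 -> Cmult c (Cmult (Cinv c) x) = x).
    { intros c x hc; rewrite Cmult_assoc, Cinv_r, Cmult_1_l by exact hc; reflexivity. }
    assert (K' : forall c x, c <> RtoC 0 -> Cmult (Cinv c) (Cmult c x) = x).
    { intros c x hc; rewrite Cmult_assoc, Cinv_l, Cmult_1_l by exact hc; reflexivity. }
    exists (Cinv a), (Cinv b); rewrite !Cmod_inv by assumption; rewrite E1.
    split; [reflexivity|]; split; [apply Rinv_0_lt_compat; lra|]; split.
    + rewrite H, E3; simpl; rewrite !K' by assumption; apply surjective_pairing.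
    + intros y; exists n; right; rewrite E3; simpl; rewrite !K by assumption.
      apply surjective_pairing.
Qed.

Lemma orbit_sym z w : orbit g z w -> orbit g w z.
Proof. intros [n [H|H]]; exists n; [right | left]; exact H. Qed.

(** [orbit] uses only forward iterates; cancelling them is what makes it transitive when two points
    have a common iterate. *)
Lemma linear_gen_inj n z w : Nat.iter n g z = Nat.iter n g w -> z = w.
Proof.
  destruct (iter_linear_gen n) as (a & b & E1 & E2 & E3); rewrite !E3; intros H.
  assert (ha : 0 < Cmod a) by (rewrite E2; apply pow_lt; lra).
  assert (a0 : a <> RtoC 0) by (apply Cmod_gt_0, ha).
  assert (b0 : b <> RtoC 0) by (apply Cmod_gt_0; lra).
  assert (K : forall c x y, c <> RtoC 0 -> Cmult c x = Cmult c y -> x = y).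
  { intros c x y hc E; apply (f_equal (Cmult (Cinv c))) in E.
    rewrite !Cmult_assoc, Cinv_l, !Cmult_1_l in E by exact hc; exact E. }
  apply injective_projections; [apply (K a _ _ a0) | apply (K b _ _ b0)];
    [exact (f_equal fst H) | exact (f_equal snd H)].
Qed.

Lemma orbit_trans z w u : orbit g z w -> orbit g w u -> orbit g z u.
Proof.
  intros [n [H|H]] [m [K|K]].
  - exists (m + n)%nat; left; rewrite Nat.iter_add, <- H; exact K.
  - destruct (Nat.le_gt_cases m n) as [J|J].
    + exists (n - m)%nat; left; apply (linear_gen_inj m).
      rewrite <- Nat.iter_add, <- K, H; f_equal; lia.
    + exists (m - n)%nat; right; apply (linear_gen_inj n).
      rewrite <- Nat.iter_add, <- H, K; f_equal; lia.
  - destruct (Nat.le_gt_cases m n) as [J|J].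
    + exists (n - m)%nat; right; rewrite H, K, <- Nat.iter_add; f_equal; lia.
    + exists (m - n)%nat; left; rewrite H, K, <- Nat.iter_add; f_equal; lia.
  - exists (n + m)%nat; right; rewrite Nat.iter_add, <- K; exact H.
Qed.

Lemma fibre_orbit_iff (p : H_lin alpha beta) z w : fibre p z -> (fibre p w <-> orbit g z w).
Proof.
  destruct (fibre_orbit _ _ p) as (z1 & _ & ->); intros H; split; intros K.
  - apply (orbit_trans z z1); [apply orbit_sym, H | exact K].
  - apply (orbit_trans z1 z); assumption.
Qed.

Lemma fibre_nonzero (p : H_lin alpha beta) : exists z, fibre p z /\ z <> zero.
Proof.
  destruct (fibre_orbit _ _ p) as (z & hz & E); exists z; split; [|exact hz].
  rewrite E; exists 0%nat; left; reflexivity.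
Qed.

(** A nonzero power of the generator changes [sq] by a factor of at least [|beta|^2] or at most its
    inverse, while the ratio of the bounds of this open annulus is exactly [|beta|^2]. So the
    annulus injects into the quotient. *)
Lemma annulus_unique c z w : orbit g z w ->
  c / Cmod beta < sq z < c * Cmod beta -> c / Cmod beta < sq w < c * Cmod beta -> z = w.
Proof.
  set (m := Cmod beta); assert (hm : 1 < m) by exact h_beta.
  assert (K : forall n z w, w = Nat.iter n g z -> c / m < sq z < c * m ->
    c / m < sq w < c * m -> z = w).
  { intros n x y E hx hy; destruct n as [|n]; [symmetry; exact E|exfalso].
    destruct (iter_linear_gen (S n)) as (a & b & E1 & E2 & E3).
    assert (Es : sq y = (Cmod a)² * sq x).
    { rewrite E, E3; unfold sq; simpl; rewrite !Cmod_mult, <- E1, !Rsqr_mult; ring. }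
    assert (hn : 1 <= m ^ n) by (apply pow_R1_Rle; lra).
    assert (hma : m <= Cmod a) by (rewrite E2; simpl; fold m; nra).
    assert (hm2 : m² <= (Cmod a)²) by (apply Rsqr_incr_1; lra).
    assert (hc : c * m = m² * (c / m)) by (unfold Rsqr; field; lra).
    assert (hm0 : 0 < m²) by (apply Rsqr_pos_lt; lra).
    pose proof (sq_ge0 x).
    assert (m² * (c / m) < m² * sq x) by (apply Rmult_lt_compat_l; lra).
    assert (m² * sq x <= (Cmod a)² * sq x) by (apply Rmult_le_compat_r; lra).
    lra. }
  intros [n [H|H]] hz hw; [apply (K n) | symmetry; apply (K n)]; assumption.
Qed.

(** The annulus around a representative [z0] of [x] serves as a chart: a point goes to the class of
    [iota w], with [w] its unique representative there. Above any other sheet the lift is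
    [diag_iota], for the power of the generator that moves the sheet to the annulus. *)
Theorem immersion_equal_moduli (N : dim) (hN : forall k, beyond N k -> (2 <= k)%nat)
  (lambda : C) : local_lck_immersion alpha beta Phi N lambda.
Proof.
  intros x; destruct (fibre_nonzero x) as (z0 & Hz0 & z0_nz).
  set (m := Cmod beta); set (c := sq z0).
  assert (hc : 0 < c) by (apply C2_nonzero, z0_nz).
  assert (hm : 1 < m) by exact h_beta.
  set (Ann := fun w : C2 => c / m < sq w < c * m).
  assert (hcm : 0 < c / m) by (apply Rdiv_lt_0_compat; lra).
  assert (Ann_nz : forall w, Ann w -> w <> zero).
  { intros w [hw _] E; rewrite E, sq_zero in hw; lra. }
  set (h := fun z : Cn_NormedModule N => scal lambda z).
  assert (iota_nz : forall w, w <> zero -> iota N hN w <> zero).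
  { intros w hw E; pose proof (sqnorm_iota N hN w) as K; pose proof (C2_nonzero w hw) as P.
    change (0 < sq w) in P; rewrite E, sqnorm_rip in K.
    rewrite rip_self in K; change (@zero (Cn_NormedModule N)) with (Cn_zero N) in K.
    rewrite Cn_norm_zero in K; unfold Rsqr in K; lra. }
  assert (HF : forall p : H_lin alpha beta, exists q : H_classical N lambda,
    forall w, fibre p w -> Ann w -> fibre q = orbit h (iota N hN w)).
  { intros p.
    destruct (classic (exists w, fibre p w /\ Ann w)) as [(w & hw & Aw)|no].
    - exists (mkHopf _ h (orbit h (iota N hN w))
        (ex_intro _ (iota N hN w) (conj (iota_nz w (Ann_nz w Aw)) eq_refl))).
      intros w' hw' Aw'; simpl; do 2 f_equal.
      apply (annulus_unique c); [|exact Aw | exact Aw'].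
      apply (fibre_orbit_iff p); assumption.
    (* Default value at points that miss the annulus; they lie outside [U]. *)
    - exists (mkHopf _ h (orbit h (iota N hN z0))
        (ex_intro _ (iota N hN z0) (conj (iota_nz z0 z0_nz) eq_refl))).
      intros w hw Aw; exfalso; apply no; exists w; split; assumption. }
  destruct (choice _ HF) as [F HF']; clear HF.
  set (U := fun p : H_lin alpha beta => exists w, fibre p w /\ Ann w).
  assert (HU : forall z, preimage U z -> exists a b, Cmod a = Cmod b /\ 0 < Cmod a /\
    Ann (Cmult a (fst z), Cmult b (snd z)) /\
    forall y, orbit g y (Cmult a (fst y), Cmult b (snd y))).
  { intros z (p & hz & w & hw & Aw).
    destruct (orbit_diag z w) as (a & b & E1 & E2 & E3 & E4).
    { apply (fibre_orbit_iff p); assumption. }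
    exists a, b; rewrite <- E3; repeat split; try assumption; apply Aw. }
  assert (HD : forall a b, Cmod a = Cmod b ->
    open (fun y : C2 => Ann (Cmult a (fst y), Cmult b (snd y)))).
  { intros a b hab.
    assert (Es : forall y : C2, sq (Cmult a (fst y), Cmult b (snd y)) = (Cmod a)² * sq y).
    { intros y; unfold sq; simpl; rewrite !Cmod_mult, <- hab, !Rsqr_mult; ring. }
    apply (open_ext (fun y : C2 => c / m < (Cmod a)² * sq y /\ (Cmod a)² * sq y < c * m)).
    { intros y; unfold Ann; rewrite Es; tauto. }
    apply open_and.
    - apply (open_comp (fun y : C2 => (Cmod a)² * sq y) (fun s => c / m < s));
        [intros y _; apply continuous_Rmult_sq | apply open_gt].
    - apply (open_comp (fun y : C2 => (Cmod a)² * sq y) (fun s => s < c * m));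
        [intros y _; apply continuous_Rmult_sq | apply open_lt]. }
  assert (HDU : forall a b y, Ann (Cmult a (fst y), Cmult b (snd y)) -> y <> zero).
  { intros a b y Ay E; apply (Ann_nz _ Ay); rewrite E; unfold zero; simpl.
    rewrite !Cmult_0_r; reflexivity. }
  exists U, F; split; [|split].
  - intros z hz; destruct (HU z hz) as (a & b & E1 & E2 & E3 & E4).
    generalize (HD a b E1 z E3); apply filter_imp; intros y Ay.
    assert (hy : y <> zero) by (apply (HDU a b), Ay).
    exists (mkHopf C2 g (orbit g y) (ex_intro _ y (conj hy eq_refl))); split.
    + exists 0%nat; left; reflexivity.
    + eexists; split; [apply E4 | exact Ay].
  - exists z0; split; [exact Hz0|]; unfold Ann; fold c; split.
    + apply (Rmult_lt_reg_r m); [lra|]; unfold Rdiv; rewrite Rmult_assoc, Rinv_l; nra.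
    + nra.
  - intros z hz; destruct (HU z hz) as (a & b & E1 & E2 & E3 & E4).
    pose proof (diag_iota_linear N hN a b E1 E2) as Hl.
    exists (fun y => Ann (Cmult a (fst y), Cmult b (snd y))), (diag_iota N hN a b).
    split; [exact E3|]; split.
    + split; [apply HD, E1|]; split.
      * intros y _; exists (diag_iota N hN a b); apply filterdiff_linear, Hl.
      * intros y Ay; split; [apply (HDU a b), Ay|].
        intros p hp; rewrite (HF' p (Cmult a (fst y), Cmult b (snd y))).
        -- exists 0%nat; left; reflexivity.
        -- apply (fibre_orbit_iff p y); [exact hp | apply E4].
        -- exact Ay.
    + intros y Ay; exists (diag_iota N hN a b); split; [apply filterdiff_linear, Hl|].
      intros v w; apply lck_form_diag_iota; [exact E1 | exact E2 | apply (HDU a b), Ay].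
Qed.

(** On a kernel vector [v] of the differential the pulled-back form vanishes, whereas the form of
    [Phi] on [v], [i v] equals [4 |v|^2 / |z|^2]. *)
Theorem no_immersion_in_lower_dim (n : nat) (lambda : C) (x : H_lin alpha beta) :
  lambda <> RtoC 0 -> (n < 2)%nat -> ~ lck_immersion_near alpha beta Phi (Some n) lambda x.
Proof.
  intros hl hn Himm; destruct (fibre_nonzero x) as (z & Hz & _).
  destruct (lck_immersion_lift alpha beta Phi (Some n) lambda x z hl Hz Himm)
    as (D & f & _ & hD & Hf).
  destruct (Hf z hD) as (z_nz & hpos & L & [HL _] & E).
  (* Since [n < 2], all coordinates of index at least 1 vanish, so coordinate 0 decides whether [L]
     vanishes. *)
  set (p := coord (L (RtoC 1, RtoC 0)) 0%nat); set (q := coord (L (RtoC 0, RtoC 1)) 0%nat).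
  assert (EL : forall u v : C, L (u, v) = Cn_zero (Some n) <-> Cplus (Cmult u p) (Cmult v q) = RtoC 0).
  { intros u v.
    assert (Ec : forall k, coord (L (u, v)) k = Cplus (Cmult u (coord (L (RtoC 1, RtoC 0)) k))
      (Cmult v (coord (L (RtoC 0, RtoC 1)) k))).
    { intros k.
      replace ((u, v) : C2) with
        (plus (scal u ((RtoC 1, RtoC 0) : C2)) (scal v ((RtoC 0, RtoC 1) : C2)) : C2).
      - rewrite (linear_plus L HL), !(linear_scal L HL); reflexivity.
      - unfold plus, scal; simpl; unfold prod_plus, prod_scal, plus, scal; simpl.
        unfold mult; simpl; f_equal; ring. }
    split; intros H.
    - transitivity (coord (L (u, v)) 0%nat); [symmetry; apply Ec | rewrite H; reflexivity].
    - apply Cn_ext; intros [|k]; [exact (eq_trans (Ec 0%nat) H)|].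
      rewrite (coord_beyond (L (u, v))) by (simpl; lia); reflexivity. }
  (* [(q, -p)] is always sent to zero, but it may itself be zero when [p = 0]; in that case [(1, 0)]
     serves. *)
  assert (Hker : exists v : C2, v <> zero /\ L v = Cn_zero (Some n)).
  { destruct (classic (p = RtoC 0)) as [hp|hp].
    - exists (RtoC 1, RtoC 0); split; [|apply EL; rewrite hp; ring].
      intros K; apply (f_equal (fun v : C2 => fst (fst v))) in K; simpl in K.
      unfold zero in K; simpl in K; lra.
    - exists (q, Copp p); split; [|apply EL; ring].
      intros K; apply (f_equal (fun v : C2 => Copp (snd v))) in K; simpl in K.
      apply hp; transitivity (Copp (Copp p)); [ring|].
      rewrite K; unfold zero; simpl; ring. }
  destruct Hker as (v & hv & Lv).
  specialize (E v).
  rewrite Lv, (rip_self (Cn_zero (Some n))), Cn_norm_zero in E.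
  assert (h1 : 0 < Cmod (RtoC 1)) by (rewrite Cmod_1; lra).
  pose proof (diag_iota_linear None beyond_None (RtoC 1) (RtoC 1) eq_refl h1) as Hl.
  (* The form of [Phi] is evaluated through the isometric inclusion into l^2(C), where
     [lck_form_sqnorm_Ci] gives its sign. *)
  rewrite <- (lck_form_diag_iota None beyond_None (RtoC 1) (RtoC 1) z v _ eq_refl h1 z_nz) in E.
  rewrite (linear_scal _ Hl), lck_form_sqnorm_Ci, <- !sqnorm_rip, !sqnorm_diag_iota, Cmod_1 in E
    by reflexivity.
  pose proof (C2_nonzero z z_nz) as Pz; pose proof (C2_nonzero v hv) as Pv.
  change (0 < sq z) in Pz; change (0 < sq v) in Pv.
  assert (0 < 4 * (1² * sq v) / (1² * sq z)).
  { apply Rdiv_lt_0_compat; unfold Rsqr; lra. }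
  rewrite <- E in H; unfold Rsqr, Rdiv in H; lra.
Qed.

End EqualModuli.

Theorem corollary4p2 (alpha beta : C) (Phi : C2 -> R)
  (h_beta : 1 < Cmod beta) (h_alpha : Cmod beta <= Cmod alpha)
  (h_Phi : Gauduchon_Ornea_potential alpha beta Phi) :
  (forall lambda : C, classical_parameter lambda ->
     (local_lck_immersion alpha beta Phi None lambda <-> Cmod alpha = Cmod beta))
  /\
  (Cmod alpha = Cmod beta ->
     forall lambda : C, lambda = RtoC (Cmod alpha) ->
       lambda = RtoC (Cmod beta) /\
       classical_parameter lambda /\
       local_lck_immersion alpha beta Phi None lambda /\
       full_lck_immersion alpha beta Phi 2 lambda).
Proof.
  split.
  - intros lambda [hl _]; split.
    + intros Himm; destruct (Rle_lt_or_eq_dec _ _ h_alpha) as [hlt|heq]; [exfalso | symmetry; exact heq].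
      (* A single point is enough to obstruct: the class of [(0, 1)], on the axis [z_1 = 0]. *)
      set (x := mkHopf C2 (linear_gen alpha beta) (orbit (linear_gen alpha beta) (RtoC 0, RtoC 1))
        (ex_intro _ ((RtoC 0, RtoC 1) : C2) (conj (slice_nonzero (RtoC 0)) eq_refl))).
      apply (no_immersion_near_axis alpha beta Phi h_beta h_alpha h_Phi None lambda x hlt hl);
        [exists 0%nat; left; reflexivity | apply Himm].
    + intros heq; apply immersion_equal_moduli; try assumption; apply beyond_None.
  - intros heq lambda El.
    assert (hcl : classical_parameter lambda).
    { rewrite El; split.
      - intros K; apply (f_equal fst) in K; simpl in K; lra.
      - rewrite Cmod_R, Rabs_pos_eq by lra; lra. }
    repeat apply conj; try apply hcl.
    + rewrite El, heq; reflexivity.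
    + apply immersion_equal_moduli; try assumption; apply beyond_None.
    + apply immersion_equal_moduli; try assumption; intros k hk; exact hk.
    + intros m x hm; apply no_immersion_in_lower_dim; try assumption; apply hcl.
Qed.
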